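(* Let $\alpha,\gamma_1,\gamma_2\ge0$, let $p\ge1$ be an integer, let $u$ be the solution of the nonlinear Schrödinger equation $i\partial_tu=-\Delta u+\mu|u|^2u$ on $\mathbb{T}^d$ with $u(0)=u_0$, and let $T>0$ be smaller than its maximal existence time. Let $\Phi_t(v)=e^{it\Delta}v+\widetilde\Phi_t(v)$, $t=\pm\tau$, $v\in H^\alpha$, be the flow of a one-step scheme such that, for all $0<\tau\le\tau_*$ with some $\tau_*>0$, with $t_n=n\tau$, $\mathcal{R}^n_{\pm\tau}:=u(t_n\pm\tau)-\Phi_{\pm\tau}(u(t_n))$: (i) there is a continuous function $M:\mathbb{R}\times\mathbb{R}\to\mathbb{R}_{\ge0}$ such that for all $v,w\in H^\alpha$, $\|\widetilde\Phi_{\pm\tau}(v)-\widetilde\Phi_{\pm\tau}(w)\|_{H^\alpha}\le\tau M(\|v\|_{H^\alpha},\|w\|_{H^\alpha})\|v-w\|_{H^\alpha}$; (ii) there is a continuous increasing function $C:\mathbb{R}_{\ge0}\to\mathbb{R}_{\ge0}$ such that for $0\le n\le T/\tau-1$, $\|\mathcal{R}^n_\tau\|_{H^\alpha}+\|\mathcal{R}^{n+1}_{-\tau}\|_{H^\alpha}\le\tau^{p+1}C\bigl(\sup_{t\in[t_n,t_{n+1}]}\|u(t)\|_{H^{\alpha+\gamma_1}}\bigr)$. Let $u^n$ be computed by $$u^{n+1}=e^{2i\tau\Delta}u^{n-1}+\widetilde\Phi_\tau(u^n)-e^{2i\tau\Delta}\widetilde\Phi_{-\tau}(u^n)\ (n\ge1),\qquad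 u^1=e^{i\tau\Delta}u_0+\widetilde\Phi_\tau(u_0),\quad u^0=u_0.$$ Then for all $0<\tau\le\tau_0$ with $\tau_0>0$ sufficiently small depending on $M_{\alpha+\gamma_1}$ and $T$, $$\|u(t_n)-u^n\|_{H^\alpha}\le C(M_{\alpha+\gamma_1})\,\tau^p,\qquad 0\le n\le T/\tau.$$ If, in addition, (iii) $p$ is odd and there is a continuous increasing function $\widetilde C:\mathbb{R}_{\ge0}\to\mathbb{R}_{\ge0}$ such that for $0<\tau\le\tau_*$ and $1\le n\le T/\tau-1$, $\|\mathcal{R}^n_\tau-e^{2i\tau\Delta}\mathcal{R}^n_{-\tau}\|_{H^\alpha}\le\tau^{p+2}\widetilde C\bigl(\sup_{t\in[t_{n-1},t_{n+1}]}\|u(t)\|_{H^{\alpha+\gamma_1+\gamma_2}}\bigr)$, then $$\|u(t_n)-u^n\|_{H^\alpha}\le C(M_{\alpha+\gamma_1+\gamma_2})\,\tau^{p+1},\qquad 0\le n\le T/\tau.$$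
   Context: $\mathbb{T}^d$, $d\in\{1,2,3\}$, is the $2\pi$-periodic torus, $\mu$ a nonzero real constant; $H^\alpha=H^\alpha(\mathbb{T}^d)$ is the periodic Sobolev space with norm $\|u\|_{H^\alpha}^2=\sum_{\mathbf{k}\in\mathbb{Z}^d}(1+|\mathbf{k}|^2)^\alpha|\hat u_{\mathbf{k}}|^2$. $e^{it\Delta}$ is the Fourier multiplier with symbol $e^{-it|\mathbf{k}|^2}$. For $\delta\ge0$, $M_\delta:=\sup_{0\le t\le T}\|u(t)\|_{H^\delta}$, and the quantities $M_{\alpha+\gamma_1}$ (respectively $M_{\alpha+\gamma_1+\gamma_2}$ in the second part) are assumed finite. The functions $M$, $C$, $\widetilde C$ in (i)–(iii) are independent of $\tau$ and $n$. In the conclusions, $C(M_\delta)$ denotes a generic positive constant (not the function in (ii)) depending on $M_\delta$ and on the fixed data ($T$, $\alpha$, $p$, $\tau_*$ and the functions in (i)–(iii)), but independent of $\tau$ and $n$; likewise $\tau_0$ may depend on the fixed data. *)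

(* Defs.v *)
From HB Require Import structures.
From mathcomp Require Import all_boot all_order all_algebra.
From mathcomp Require Import complex.
From mathcomp Require Import all_classical all_reals all_analysis.

Set Implicit Arguments.
Unset Strict Implicit.
Unset Printing Implicit Defensive.

Import Order.TTheory GRing.Theory Num.Theory.
Import numFieldNormedType.Exports.

Local Open Scope classical_set_scope.
Local Open Scope ring_scope.
Local Open Scope complex_scope.

Section Complex.
Context {R : realType}.

Definition expi (x : R) : R[i] := cos x +i* sin x.

Context {disp : measure_display} {X : measurableType disp}.
Variables (m : {measure set X -> \bar R}) (D : set X).

Definition cintegrable (f : X -> R[i]) : Prop :=
  m.-integrable D (EFin \o @complex.Re R \o f) /\
  m.-integrable D (EFin \o @complex.Im R \o f).

Definition cintegral (f : X -> R[i]) : R[i] :=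
  (\int[m]_(x in D) complex.Re (f x)) +i* (\int[m]_(x in D) complex.Im (f x)).

End Complex.

Section Torus.
Context {R : realType}.

(* The torus is parametrized by the fundamental domain [0, 2 pi]^d: a function
   on it is a function of d real variables considered up to equality almost
   everywhere for [torus_prob d], so that its values outside [0, 2 pi]^d are
   irrelevant and no periodicity condition is needed. *)
Definition torus (d : nat) := d.-tuple (measurableTypeR R).

Definition freq (d : nat) := d.-tuple int.

Lemma two_pi_gt0 : (0 : R) < 2 * pi.
Proof. by rewrite mulr_gt0 ?pi_gt0. Qed.

Definition tcons (d : nat) (x : measurableTypeR R * torus d) : torus d.+1 :=
  [tuple of x.1 :: x.2].

Lemma measurable_tcons d : measurable_fun setT (@tcons d).
Proof. exact: measurable_cons. Qed.

HB.instance Definition _ d := @isMeasurableFun.Build _ _ _ _ (@tcons d)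
  (@measurable_tcons d).

(* (2 pi)^-d times the Lebesgue measure on [0, 2 pi]^d *)
Fixpoint torus_prob (d : nat) : probability (torus d) R :=
  match d with
  | 0 => \d_([tuple] : torus 0)
  | d'.+1 => distribution (uniform_prob two_pi_gt0 \x torus_prob d')%E
                          (@tcons d')
  end.

Variable d : nat.
Implicit Types (f g : torus d -> R[i]) (k : freq d).

Definition dotk k (x : torus d) : R := \sum_(j < d) (tnth k j)%:~R * tnth x j.

Definition sqrk k : R := \sum_(j < d) (tnth k j)%:~R ^+ 2.

Definition integrable_torus f : Prop := cintegrable (torus_prob d) setT f.

Definition fourier f k : R[i] :=
  cintegral (torus_prob d) setT (fun x => f x * expi (- dotk k x)).

(* extended-real valued, so that an infinite norm is not read as a number *)
Definition Hnorm (a : R) f : \bar R :=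
  sqrte (\esum_(k in [set: freq d])
    ((1 + sqrk k) `^ a * Normc.normc (fourier f k) ^+ 2)%:E).

Arguments Hnorm a%_R f%_R.

(* Used for a >= 0 only, so integrability is no restriction: H^a is then
   contained in L^2, hence in L^1. *)
Definition Hspace (a : R) : set (torus d -> R[i]) :=
  [set f | integrable_torus f /\ (Hnorm a f < +oo)%E].

(* The operator f |-> g with g^_k = s_k f^_k; g is unique up to equality
   almost everywhere, and exists for f in L^2 and s bounded (Riesz-Fischer). *)
Definition fourier_multiplier (s : freq d -> R[i]) f : torus d -> R[i] :=
  xget (cst 0) [set g | integrable_torus g /\
                        forall k, fourier g k = s k * fourier f k].

(* e^{it Delta} *)
Definition schroedinger (t : R) : (torus d -> R[i]) -> (torus d -> R[i]) :=
  fourier_multiplier (fun k => expi (- (t * sqrk k))).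

Definition sup_Hnorm (a : R) (u : R -> torus d -> R[i]) (t1 t2 : R) : \bar R :=
  ereal_sup [set Hnorm a (u t) | t in `[t1, t2]].

Definition cubic f : torus d -> R[i] :=
  fun x => (Normc.normc (f x) ^+ 2)%:C * f x.

(* u solves i u_t = - Delta u + mu |u|^2 u on [0, Tm) in the sense of
   distributions, in the class C([0, Tm); H^a): the equation is tested against
   the exponentials e^{ik.x} and integrated in time. *)
Definition nls_solution (mu a : R) (Tm : \bar R) (u : R -> torus d -> R[i]) :=
  forall t : R, 0 <= t -> (t%:E < Tm)%E ->
  [/\ Hspace a (u t),
      (fun s => Hnorm a (u s \- u t))
        @ within [set s : R | 0 <= s /\ (s%:E < Tm)%E] (nbhs t) --> 0%E,
      {ae lebesgue_measure, forall s : R,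
        s \in `[0, t] -> integrable_torus (cubic (u s))} &
      forall k,
        cintegrable lebesgue_measure `[0, t]
          (fun s : measurableTypeR R => fourier (cubic (u s)) k) /\
        'i%C * (fourier (u t) k - fourier (u 0) k) =
        cintegral lebesgue_measure `[0, t]
          (fun s : measurableTypeR R =>
             (sqrk k)%:C * fourier (u s) k +
             mu%:C * fourier (cubic (u s)) k)].

(* Tm is the maximal existence time of u. *)
Definition nls_maximal_solution (mu a : R) (u0 : torus d -> R[i]) (Tm : \bar R)
    (u : R -> torus d -> R[i]) :=
  [/\ Hspace a u0,
      nls_solution mu a Tm u,
      ae_eq (torus_prob d) setT (u 0) u0 &
      forall (Tm' : \bar R) (v : R -> torus d -> R[i]),
        nls_solution mu a Tm' v ->
        (forall t : R, 0 <= t -> (t%:E < Tm)%E ->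
           ae_eq (torus_prob d) setT (v t) (u t)) ->
        (Tm' <= Tm)%E].

Section Scheme.
Variable Phit : R -> (torus d -> R[i]) -> (torus d -> R[i]).

Definition flow (t : R) (v : torus d -> R[i]) : torus d -> R[i] :=
  schroedinger t v \+ Phit t v.

(* R^n_s with time step tau; s is tau or - tau *)
Definition residual (u : R -> torus d -> R[i]) (tau : R) (n : nat) (s : R) :
    torus d -> R[i] :=
  u (n%:R * tau + s) \- flow s (u (n%:R * tau)).

Definition flow_lipschitz (a taus : R) (M : R * R -> R) : Prop :=
  forall tau : R, 0 < tau <= taus ->
  forall s : R, s = tau \/ s = - tau ->
  forall v w, Hspace a v -> Hspace a w ->
  (Hnorm a (Phit s v \- Phit s w) <=
    (tau * M (fine (Hnorm a v), fine (Hnorm a w)))%:E * Hnorm a (v \- w))%E.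

Definition local_error (u : R -> torus d -> R[i]) (a b T taus : R) (p : nat)
    (C : R -> R) : Prop :=
  forall tau : R, 0 < tau <= taus ->
  forall n : nat, n%:R <= T / tau - 1 ->
  (Hnorm a (residual u tau n tau) + Hnorm a (residual u tau n.+1 (- tau)) <=
    (tau ^+ p.+1 *
      C (fine (sup_Hnorm b u (n%:R * tau) (n.+1%:R * tau))))%:E)%E.

Definition symmetric_local_error (u : R -> torus d -> R[i]) (a b T taus : R)
    (p : nat) (C : R -> R) : Prop :=
  forall tau : R, 0 < tau <= taus ->
  forall n : nat, (1 <= n)%N -> n%:R <= T / tau - 1 ->
  (Hnorm a (residual u tau n tau \-
            schroedinger (2 * tau) (residual u tau n (- tau))) <=
    (tau ^+ p.+2 *
      C (fine (sup_Hnorm b u (n.-1%:R * tau) (n.+1%:R * tau))))%:E)%E.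

Fixpoint two_step (tau : R) (u0 : torus d -> R[i]) (n : nat) :
    torus d -> R[i] :=
  match n with
  | 0 => u0
  | 1 => schroedinger tau u0 \+ Phit tau u0
  | (m.+1 as n').+1 =>
      (schroedinger (2 * tau) (two_step tau u0 m)
        \+ Phit tau (two_step tau u0 n'))
      \- schroedinger (2 * tau) (Phit (- tau) (two_step tau u0 n'))
  end.

End Scheme.

End Torus.

Arguments torus : clear implicits.
Arguments Hnorm {R d} a%_R f%_R.

Section Profile.
Context {R : realType}.

(* continuous increasing function from [0, +oo) to [0, +oo) *)
Definition increasing_profile (C : R -> R) : Prop :=
  [/\ {within `[0, +oo[, continuous C},
      (forall x, 0 <= x -> 0 <= C x) &
      (forall x y, 0 <= x -> x <= y -> C x <= C y)].

End Profile.

(* Main.v *)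
Require Import Defs.
From HB Require Import structures.
From mathcomp Require Import all_boot all_order all_algebra.
From mathcomp Require Import complex ring lra finmap.
From mathcomp Require Import all_classical all_reals all_analysis.
From mathcomp Require Import measurable_realfun.

Set Implicit Arguments.
Unset Strict Implicit.
Unset Printing Implicit Defensive.

Import Order.TTheory GRing.Theory Num.Theory.
Import numFieldNormedType.Exports.

Local Open Scope classical_set_scope.
Local Open Scope ring_scope.

(** With e_n = u(t_n) - u^n, the identity e^{2 i tau Delta} e^{- i tau Delta} =
    e^{i tau Delta} turns the definition of the scheme into
      e_{n+1} = e^{2 i tau Delta} e_{n-1}
                + [Phit_tau(u(t_n)) - Phit_tau(u^n)]
                - e^{2 i tau Delta} [Phit_{-tau}(u(t_n)) - Phit_{-tau}(u^n)]
                + R^n_tau - e^{2 i tau Delta} R^n_{-tau}.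
    Since e^{2 i tau Delta} is an isometry of H^alpha, s_n = |e_n| + |e_{n-1}|
    satisfies s_{n+1} <= (1 + 2 tau L) s_n + |R^n_tau - e^{2 i tau Delta}
    R^n_{-tau}|, where L bounds M as long as |e_n| <= 1; a discrete Gronwall
    bootstrap gives order p, and the smaller symmetric residual gives order
    p + 1. Only Fourier coefficients enter these norms, so the one analytic
    input is that the multiplier e^{i t Delta} exists on H^alpha, which is the
    Riesz-Fischer theorem: a lacunary choice of partial Fourier sums converges
    in L^1 by dominated convergence. *)

(** * Real and imaginary parts of complex arithmetic *)

Section ComplexAlgebra.
Context {R : rcfType}.
Implicit Types z w : R[i].

Lemma complexReM z w : complex.Re (z * w) =
  complex.Re z * complex.Re w - complex.Im z * complex.Im w.
Proof. by case: z w => [a b] [c e]. Qed.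

Lemma complexImM z w : complex.Im (z * w) =
  complex.Re z * complex.Im w + complex.Im z * complex.Re w.
Proof. by case: z w => [a b] [c e]. Qed.

Lemma complexReD z w : complex.Re (z + w) = complex.Re z + complex.Re w.
Proof. by case: z w => [a b] [c e]. Qed.

Lemma complexImD z w : complex.Im (z + w) = complex.Im z + complex.Im w.
Proof. by case: z w => [a b] [c e]. Qed.

Lemma normc_sqrE z : Normc.normc z ^+ 2 =
  complex.Re z ^+ 2 + complex.Im z ^+ 2.
Proof. by case: z => a b; rewrite /= sqr_sqrtr// addr_ge0 ?sqr_ge0. Qed.

Lemma complex_ext z w :
  complex.Re z = complex.Re w -> complex.Im z = complex.Im w -> z = w.
Proof. by case: z w => [a b] [c e] /= -> ->. Qed.

End ComplexAlgebra.

(** * Linearity of the complex integral over a probability space *)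

Section ComplexIntegral.
Context {disp} {X : measurableType disp} {R : realType} (m : probability X R).
Implicit Types f g phi : X -> R[i].

Let mT_lty : (m setT < +oo)%E.
Proof. by rewrite probability_setT ltry. Qed.

Lemma integrableM_bounded (f phi : X -> R) : m.-integrable setT (EFin \o f) ->
  measurable_fun setT phi -> (forall x, `|phi x| <= 1) ->
  m.-integrable setT (EFin \o (fun x => f x * phi x)).
Proof.
move=> fi mphi phi1.
have -> : EFin \o (fun x => f x * phi x) = ((EFin \o f) \* (EFin \o phi))%E.
  by apply/funext => x /=; rewrite EFinM.
apply: integrableMl => //; exists 1; split => // M M1 x _ /=.
exact: le_trans (phi1 x) (ltW M1).
Qed.

(** A class of factors that preserve integrability. The two parts are bounded separately because a
    complex product is integrated as four real products, each covered by [integrableM_bounded]. *)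
Definition unit_bounded phi : Prop :=
  [/\ measurable_fun setT (@complex.Re R \o phi),
      measurable_fun setT (@complex.Im R \o phi) &
      forall x, `|complex.Re (phi x)| <= 1 /\ `|complex.Im (phi x)| <= 1].

Lemma cintegrableD f g : cintegrable m setT f -> cintegrable m setT g ->
  cintegrable m setT (f \+ g).
Proof.
move=> [f1 f2] [g1 g2]; split.
- have -> : EFin \o @complex.Re R \o (f \+ g) =
    ((EFin \o @complex.Re R \o f) \+ (EFin \o @complex.Re R \o g))%E.
    by apply/funext => x /=; rewrite complexReD EFinD.
  exact: integrableD.
- have -> : EFin \o @complex.Im R \o (f \+ g) =
    ((EFin \o @complex.Im R \o f) \+ (EFin \o @complex.Im R \o g))%E.
    by apply/funext => x /=; rewrite complexImD EFinD.
  exact: integrableD.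
Qed.

Lemma cintegrableM f phi : cintegrable m setT f -> unit_bounded phi ->
  cintegrable m setT (fun x => f x * phi x).
Proof.
move=> [f1 f2] [mR mI phi1].
have i1 := @integrableM_bounded _ _ f1 mR (fun x => (phi1 x).1).
have i2 := @integrableM_bounded _ _ f2 mI (fun x => (phi1 x).2).
have i3 := @integrableM_bounded _ _ f1 mI (fun x => (phi1 x).2).
have i4 := @integrableM_bounded _ _ f2 mR (fun x => (phi1 x).1).
split.
- apply: eq_integrable (integrableB _ i1 i2) => // x _ /=.
  by rewrite complexReM EFinB.
- apply: eq_integrable (integrableD _ i3 i4) => // x _ /=.
  by rewrite complexImM EFinD.
Qed.

Lemma cintegrableZ (c : R[i]) f : cintegrable m setT f ->
  cintegrable m setT (fun x => c * f x).
Proof.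
move=> [f1 f2]; split.
- apply: eq_integrable (integrableB _ (integrableZl _ (complex.Re c) f1)
    (integrableZl _ (complex.Im c) f2)) => // x _ /=.
  by rewrite complexReM EFinB !EFinM.
- apply: eq_integrable (integrableD _ (integrableZl _ (complex.Re c) f2)
    (integrableZl _ (complex.Im c) f1)) => // x _ /=.
  by rewrite complexImM EFinD !EFinM.
Qed.

Lemma cintegralD f g : cintegrable m setT f -> cintegrable m setT g ->
  cintegral m setT (fun x => f x + g x) =
  cintegral m setT f + cintegral m setT g.
Proof.
move=> [f1 f2] [g1 g2]; apply: complex_ext; rewrite /= -RintegralD//;
  by apply: eq_Rintegral => x _; rewrite ?complexReD ?complexImD.
Qed.

Lemma cintegralZ (c : R[i]) f : cintegrable m setT f ->
  cintegral m setT (fun x => c * f x) = c * cintegral m setT f.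
Proof.
move=> [f1 f2]; apply: complex_ext; rewrite ?complexReM ?complexImM /=.
- rewrite -!RintegralZl// -RintegralB//; last 2 first.
  + exact: (integrableZl _ (complex.Re c) f1).
  + exact: (integrableZl _ (complex.Im c) f2).
  by apply: eq_Rintegral => x _; rewrite complexReM.
- rewrite -!RintegralZl// -RintegralD//; last 2 first.
  + exact: (integrableZl _ (complex.Re c) f2).
  + exact: (integrableZl _ (complex.Im c) f1).
  by apply: eq_Rintegral => x _; rewrite complexImM.
Qed.

Lemma cintegrable0 : cintegrable m setT (fun=> 0 : R[i]).
Proof.
by split; apply: eq_integrable (integrable0 m setT) => // x _.
Qed.

Lemma cintegral0 : cintegral m setT (fun=> 0 : R[i]) = 0.
Proof. by apply: complex_ext => /=; rewrite Rintegral_cst// mul0r. Qed.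

Lemma cintegrable_sum (I : Type) (s : seq I) (F : I -> X -> R[i]) :
  (forall i, cintegrable m setT (F i)) ->
  cintegrable m setT (fun x => \sum_(i <- s) F i x).
Proof.
move=> FI; elim: s => [|i s IH].
  by under eq_fun do rewrite big_nil; exact: cintegrable0.
by under eq_fun do rewrite big_cons; exact: cintegrableD.
Qed.

Lemma cintegral_sum (I : Type) (s : seq I) (F : I -> X -> R[i]) :
  (forall i, cintegrable m setT (F i)) ->
  cintegral m setT (fun x => \sum_(i <- s) F i x) =
  \sum_(i <- s) cintegral m setT (F i).
Proof.
move=> FI; elim: s => [|i s IH].
  by under eq_fun do rewrite big_nil; rewrite big_nil cintegral0.
under eq_fun do rewrite big_cons.
by rewrite big_cons cintegralD// ?IH//; exact: cintegrable_sum.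
Qed.

Lemma unit_bounded_cintegrable phi : unit_bounded phi ->
  cintegrable m setT phi.
Proof.
move=> [mR mI phi1]; split; apply: measurable_bounded_integrable => //.
- by exists 1; split => // M M1 x _ /=; apply: le_trans (ltW M1); case: (phi1 x).
- by exists 1; split => // M M1 x _ /=; apply: le_trans (ltW M1); case: (phi1 x).
Qed.

End ComplexIntegral.

(** * The characters of the torus as bounded measurable factors *)

Section Exponentials.
Context {R : realType}.

Lemma expiD (a b : R) : expi (a + b) = expi a * expi b.
Proof.
apply: complex_ext; rewrite ?complexReM ?complexImM /= ?cosD ?sinD //.
by rewrite addrC; congr (_ + _); rewrite mulrC.
Qed.

Lemma normc_expi (a : R) : Normc.normc (expi a) = 1.
Proof. by rewrite /= cos2Dsin2 sqrtr1. Qed.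

Lemma unit_bounded_expi {disp} {X : measurableType disp} (h : X -> R) :
  measurable_fun setT h -> unit_bounded (fun x => expi (h x)).
Proof.
move=> mh; split => [||x].
- exact: measurableT_comp
    (continuous_measurable_fun (@continuous_cos R)) mh.
- exact: measurableT_comp
    (continuous_measurable_fun (@continuous_sin R)) mh.
- by split; rewrite ler_norml /= ?cos_geN1 ?cos_le1 ?sin_geN1 ?sin_le1.
Qed.

Lemma measurable_dotk d (k : freq d) : measurable_fun setT (@dotk R d k).
Proof.
apply: measurable_sum => j; apply: measurable_funM => //.
exact: measurable_tnth.
Qed.

Lemma unit_bounded_expi_dotk d (k : freq d) :
  unit_bounded (fun x : torus R d => expi (dotk k x)).
Proof. by apply: unit_bounded_expi; exact: measurable_dotk. Qed.

Lemma unit_bounded_expi_Ndotk d (k : freq d) :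
  unit_bounded (fun x : torus R d => expi (- dotk k x)).
Proof.
by apply: unit_bounded_expi; apply: measurableT_comp => //; exact: measurable_dotk.
Qed.

End Exponentials.

(** * Integrals of products of bounded functions over a product space *)

Section Fubini.
Context {disp1 disp2} {X1 : measurableType disp1} {X2 : measurableType disp2}.
Context {R : realType} (m1 : probability X1 R) (m2 : probability X2 R).

Lemma bounded_integrable {disp} {X : measurableType disp}
    (m : probability X R) (f : X -> R) :
  measurable_fun setT f -> (forall x, `|f x| <= 1) ->
  m.-integrable setT (EFin \o f).
Proof.
move=> mf f1; have mT : (m setT < +oo)%E by rewrite probability_setT ltry.
apply: measurable_bounded_integrable => //.
by exists 1; split => // M M1 x _ /=; exact: le_trans (f1 x) (ltW M1).
Qed.

Lemma Rintegral_prob_cst {disp} {X : measurableType disp}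
    (m : probability X R) (c : R) : Rintegral m setT (fun=> c) = c.
Proof.
have mT : m setT = 1%E := probability_setT m.
by rewrite Rintegral_cst//= mT mulr1.
Qed.

Lemma Rintegral_prod (f : X1 -> R) (g : X2 -> R) :
  measurable_fun setT f -> (forall x, `|f x| <= 1) ->
  measurable_fun setT g -> (forall x, `|g x| <= 1) ->
  (m1 \x m2)%E.-integrable setT (EFin \o (fun z => f z.1 * g z.2)) /\
  Rintegral (m1 \x m2)%E setT (fun z => f z.1 * g z.2) =
  Rintegral m1 setT f * Rintegral m2 setT g.
Proof.
move=> mf f1 mg g1.
have i : (m1 \x m2)%E.-integrable setT (EFin \o (fun z => f z.1 * g z.2)).
  apply: bounded_integrable => [|z].
    apply: measurable_funM; exact: measurableT_comp.
  by rewrite normrM mulr_ile1.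
split => //; rewrite /Rintegral -(integral12_prod_meas1 i).
have fi := @bounded_integrable _ _ m1 _ mf f1.
have gi := @bounded_integrable _ _ m2 _ mg g1.
transitivity (Rintegral m1 setT (fun x => Rintegral m2 setT g * f x)).
  congr fine; apply: eq_integral => x _; rewrite /fubini_F /=.
  under eq_integral do rewrite EFinM.
  rewrite integralZl// muleC EFinM /Rintegral fineK//.
  exact: integrable_fin_num.
by rewrite RintegralZl// mulrC.
Qed.

Lemma cintegral_prod (f : X1 -> R[i]) (g : X2 -> R[i]) :
  unit_bounded f -> unit_bounded g ->
  cintegral (m1 \x m2)%E setT (fun z => f z.1 * g z.2) =
  cintegral m1 setT f * cintegral m2 setT g.
Proof.
move=> [f1 f2 f3] [g1 g2 g3].
have [i11 e11] := Rintegral_prod f1 (fun x => (f3 x).1) g1 (fun x => (g3 x).1).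
have [i12 e12] := Rintegral_prod f1 (fun x => (f3 x).1) g2 (fun x => (g3 x).2).
have [i21 e21] := Rintegral_prod f2 (fun x => (f3 x).2) g1 (fun x => (g3 x).1).
have [i22 e22] := Rintegral_prod f2 (fun x => (f3 x).2) g2 (fun x => (g3 x).2).
apply: complex_ext; rewrite ?complexReM ?complexImM /=.
- rewrite -e11 -e22 -RintegralB//; apply: eq_Rintegral => z _.
  by rewrite complexReM.
- rewrite -e12 -e21 -RintegralD//; apply: eq_Rintegral => z _.
  by rewrite complexImM.
Qed.

End Fubini.

(** * Characters of the circle under the uniform law on [0, 2 pi] *)

Section Uniform.
Context {R : realType}.
Local Notation U := (uniform_prob (@two_pi_gt0 R)).

Lemma sin_2pi_nat (n : nat) : sin (n%:R * (2 * pi)) = 0 :> R.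
Proof.
elim: n => [|n IH]; first by rewrite mul0r sin0.
by rewrite -natr1 mulrDl mul1r [X in _ + X]mulr_natl sinD2pi.
Qed.

Lemma cos_2pi_nat (n : nat) : cos (n%:R * (2 * pi)) = 1 :> R.
Proof.
elim: n => [|n IH]; first by rewrite mul0r cos0.
by rewrite -natr1 mulrDl mul1r [X in _ + X]mulr_natl cosD2pi.
Qed.

Lemma sin_2pi_int (k : int) : sin (k%:~R * (2 * pi)) = 0 :> R.
Proof.
case: k => n; first exact: sin_2pi_nat.
by rewrite NegzE mulrNz mulNr sinN sin_2pi_nat oppr0.
Qed.

Lemma cos_2pi_int (k : int) : cos (k%:~R * (2 * pi)) = 1 :> R.
Proof.
case: k => n; first exact: cos_2pi_nat.
by rewrite NegzE mulrNz mulNr cosN cos_2pi_nat.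
Qed.

(* Adding 1 makes the integrand nonnegative, as [integral_uniform] requires. *)
Lemma Rintegral_uniform_derive (f F : R -> R) :
  continuous f -> (forall x, `|f x| <= 1) ->
  (forall x : R, is_derive x 1 F (f x)) -> F (2 * pi) = F 0 ->
  Rintegral U setT f = 0.
Proof.
move=> cf f1 dF F0.
have mf : measurable_fun setT f by exact: continuous_measurable_fun.
have mf1 : measurable_fun setT (fun x => 1 + f x) by exact: measurable_funD.
have dG (x : R) : is_derive x 1 (fun y : R => y + F y) (1 + f x).
  exact: is_deriveD.
have e : (\int[U]_x (1 + f x)%:E = 1)%E.
  rewrite integral_uniform; last 2 first.
  - exact/measurable_EFinP.
  - by move=> x; rewrite lee_fin -lerBlDl sub0r; have := f1 x; rewrite ler_norml => /andP[].
  rewrite (@continuous_FTC2 _ _ (fun y : R => y + F y)).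
  - rewrite F0 -EFinB -EFinM subr0 add0r addrK mulVf//.
    by rewrite gt_eqF// two_pi_gt0.
  - exact: two_pi_gt0.
  - apply: continuous_subspaceT => x; apply: cvgD; [exact: cvg_cst|exact: cf].
  - have cG x : {for x, continuous (fun y : R => y + F y)}.
      by apply: differentiable_continuous; apply/derivable1_diffP; case: (dG x).
    split => [x _||].
    + by case: (dG x).
    + exact/cvg_at_right_filter/cG.
    + exact/cvg_at_left_filter/cG.
  - by move=> x _; rewrite derive1E; case: (dG x).
have fi := @bounded_integrable _ _ _ U _ mf f1.
have : Rintegral U setT (fun x => 1 + f x) = 1 by rewrite /Rintegral e.
rewrite RintegralD//; last exact: (finite_measure_integrable_cst U 1).
rewrite (Rintegral_prob_cst U) => /eqP.
by rewrite -subr_eq0 addrAC subrr add0r => /eqP.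
Qed.

(** For nonzero [k] the primitives sin(kx)/k and -cos(kx)/k of the two parts take equal values at 0
    and 2 pi. *)
Lemma cintegral_uniform_expi (k : int) :
  cintegral U setT (fun x => expi (k%:~R * x)) = (k == 0)%:R.
Proof.
have [->|k0] := eqVneq k 0.
  apply: complex_ext => /=; under eq_Rintegral do rewrite mul0r ?cos0 ?sin0.
    exact: (Rintegral_prob_cst U).
  exact: (Rintegral_prob_cst U).
have kR : k%:~R != 0 :> R by rewrite intr_eq0.
have dl (x : R) : is_derive x 1 (fun y : R => k%:~R * y) k%:~R.
  rewrite -[X in is_derive _ _ _ X]mulr1.
  exact: (is_deriveZ (k%:~R : R) (is_derive_id x 1)).
apply: complex_ext => /=.
- apply: (@Rintegral_uniform_derive _ (fun x => k%:~R^-1 * sin (k%:~R * x))).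
  + move=> x; apply: continuous_comp; last exact: continuous_cos.
    by apply: cvgM; [exact: cvg_cst|exact: cvg_id].
  + by move=> x; rewrite ler_norml cos_geN1 cos_le1.
  + move=> x; have := is_deriveZ (k%:~R^-1 : R) (is_derive1_comp
      (is_derive_sin (k%:~R * x)) (dl x)).
    move=> H; apply: is_derive_eq H _.
    by rewrite /GRing.scale /= mulrA mulrAC mulVf// mul1r.
  + by rewrite mulr0 sin0 sin_2pi_int.
- apply: (@Rintegral_uniform_derive _ (fun x => - k%:~R^-1 * cos (k%:~R * x))).
  + move=> x; apply: continuous_comp; last exact: continuous_sin.
    by apply: cvgM; [exact: cvg_cst|exact: cvg_id].
  + by move=> x; rewrite ler_norml sin_geN1 sin_le1.
  + move=> x; have := is_deriveZ (- k%:~R^-1 : R) (is_derive1_comp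
      (is_derive_cos (k%:~R * x)) (dl x)).
    move=> H; apply: is_derive_eq H _.
    by rewrite /GRing.scale /= mulNr mulNr mulrN opprK mulrA mulrAC mulVf// mul1r.
  + by rewrite mulr0 cos0 cos_2pi_int.
Qed.

End Uniform.

(** * Orthonormality of the characters in dimension d *)

Section Orthonormality.
Context {R : realType}.

Lemma dotk_tcons d (k0 : int) (k : freq d) (z : measurableTypeR R * torus R d) :
  dotk [tuple of k0 :: k] (tcons z) = k0%:~R * z.1 + dotk k z.2.
Proof.
rewrite /dotk big_ord_recl !tnth0; congr (_ + _).
by apply: eq_bigr => j _; rewrite !tnthS.
Qed.

(** Induction on the dimension: [torus_prob d.+1] is the image under [tcons] of a product measure,
    and along [tcons] a character splits into a character of the circle times one of the
    d-dimensional torus. In dimension 0 the character is the constant 1. *)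
Lemma cintegral_torus_expi d (k : freq d) :
  cintegral (torus_prob d) setT (fun x : torus R d => expi (dotk k x)) =
  (k == [tuple 0 | i < d])%:R.
Proof.
elim: d k => [|d IH] k.
  have -> : k = [tuple 0 | i < 0] by apply: eq_from_tnth => -[].
  rewrite eqxx.
  apply: complex_ext => /=.
    rewrite -[RHS](Rintegral_prob_cst (torus_prob 0)).
    by apply: eq_Rintegral => x _; rewrite /dotk big_ord0 cos0.
  rewrite -[RHS](Rintegral_prob_cst (torus_prob 0)).
  by apply: eq_Rintegral => x _; rewrite /dotk big_ord0 sin0.
case/tupleP: k => k0 k.
have -> : ([tuple of k0 :: k] == [tuple 0 | i < d.+1]) =
          (k0 == 0) && (k == [tuple 0 | i < d]).
  apply/eqP/andP => [E|[/eqP-> /eqP->]].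
    split; first by have := congr1 (fun t => tnth t ord0) E; rewrite tnth0 tnth_mktuple => ->.
    apply/eqP/eq_from_tnth => i.
    have := congr1 (fun t => tnth t (lift ord0 i)) E.
    by rewrite tnthS !tnth_mktuple.
  apply/eq_from_tnth => i; rewrite tnth_mktuple.
  case: (unliftP ord0 i) => [j|] ->; first by rewrite tnthS tnth_mktuple.
  by rewrite tnth0.
have m1 := @unit_bounded_expi_dotk R _ [tuple of k0 :: k].
have u1 : unit_bounded (fun x : measurableTypeR R => expi (k0%:~R * x : R)).
  apply: unit_bounded_expi; exact: measurable_funM.
transitivity (cintegral (uniform_prob (@two_pi_gt0 R) \x torus_prob d)%E setT
    (fun z => expi (k0%:~R * z.1 : R) * expi (dotk k z.2))); last first.
  rewrite (cintegral_prod _ _ u1 (unit_bounded_expi_dotk k)) IH.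
  by rewrite cintegral_uniform_expi -natrM mulnb.
case: m1 => m1 m2 m3.
pose P : probability (measurableTypeR R * torus R d)%type R :=
  (uniform_prob (@two_pi_gt0 R) \x torus_prob d)%E.
have mt : measurable_fun setT (@tcons R d) := @measurable_tcons R d.
apply: complex_ext => /=; congr fine.
- rewrite integral_distribution.
  + by apply: eq_integral => z _; rewrite /= dotk_tcons cosD.
  + exact/measurable_EFinP.
  + apply: (bounded_integrable P (measurableT_comp m1 mt)) => z.
    by case: (m3 (tcons z)).
- rewrite integral_distribution.
  + apply: eq_integral => z _; rewrite /= dotk_tcons sinD.
    by rewrite addrC; congr (_ + _)%:E.
  + exact/measurable_EFinP.
  + apply: (bounded_integrable P (measurableT_comp m2 mt)) => z.
    by case: (m3 (tcons z)).
Qed.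

Lemma dotkB d (k l : freq d) (x : torus R d) :
  dotk [tuple tnth k i - tnth l i | i < d] x = dotk k x - dotk l x.
Proof.
rewrite /dotk -sumrB; apply: eq_bigr => i _.
by rewrite tnth_mktuple intrB mulrBl.
Qed.

Lemma fourier_expi d (k l : freq d) :
  fourier (fun x : torus R d => expi (dotk k x)) l = (k == l)%:R.
Proof.
rewrite /fourier.
under [X in cintegral _ _ X]funext do rewrite -expiD -dotkB.
rewrite cintegral_torus_expi; congr (_%:R); congr nat_of_bool.
apply/eqP/eqP => [E|->].
  apply: eq_from_tnth => i; have := congr1 (fun t => tnth t i) E.
  by rewrite !tnth_mktuple => /eqP; rewrite subr_eq0 => /eqP.
by apply: eq_from_tnth => i; rewrite !tnth_mktuple subrr.
Qed.

End Orthonormality.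

(** * Absolutely convergent series in L^1 *)

Section L1Series.
Context {disp} {X : measurableType disp} {R : realType} (m : probability X R).

(** By monotone convergence G = sum |h_n| is integrable, hence finite almost everywhere; it
    dominates all partial sums, and dominated convergence applies after multiplication by [phi].
    Testing against bounded [phi] is the form in which Fourier coefficients pass to the limit. *)
Lemma L1_series (h : nat -> X -> R) :
  (forall n, m.-integrable setT (EFin \o h n)) ->
  (\sum_(0 <= n <oo) \int[m]_x (`|h n x|)%:E < +oo)%E ->
  exists2 g : X -> R, m.-integrable setT (EFin \o g) &
    forall phi : X -> R, measurable_fun setT phi -> (forall x, `|phi x| <= 1) ->
      (fun N => \sum_(n < N) Rintegral m setT (fun x => h n x * phi x)) @ \oo
        --> Rintegral m setT (fun x => g x * phi x).
Proof.
move=> hi hs.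
have mh n : measurable_fun setT (h n) by exact/measurable_EFinP/(measurable_int m).
pose G x := (\sum_(0 <= n <oo) (`|h n x|)%:E)%E.
have mG : measurable_fun setT G.
  apply: (@ge0_emeasurable_sum _ _ _ setT (fun n x => (`|h n x|)%:E) xpredT).
    by move=> n x _ _; rewrite lee_fin.
  by move=> n _; apply/measurable_EFinP; exact: measurableT_comp.
have G0 x : (0 <= G x)%E by apply: nneseries_ge0 => n _ _; rewrite lee_fin.
have iG : m.-integrable setT G.
  apply/integrableP; split => //.
  under eq_integral do rewrite gee0_abs//.
  rewrite integral_nneseries// => n.
  by apply/measurable_EFinP; exact: measurableT_comp.
have SG N x : (`|\sum_(n < N) h n x|%:E <= G x)%E.
  apply: (@le_trans _ _ (\sum_(0 <= n < N) `|h n x|%:E)%E).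
    by rewrite sumEFin lee_fin big_mkord; exact: ler_norm_sum.
  by apply: nneseries_lim_ge => n _ _; rewrite lee_fin.
have cvgS x : G x \is a fin_num ->
    cvgn (fun N => \sum_(n < N) h n x).
  move=> Gfin.
  suff: cvgn (series (fun n => h n x)).
    by congr (cvgn _); apply/funext => N; rewrite /series /= big_mkord.
  apply: normed_cvg.
  apply: nondecreasing_is_cvgn.
    apply: nondecreasing_series => n _ _ /=; exact: normr_ge0.
  exists (fine (G x)) => _ [N _ <-].
  rewrite -lee_fin fineK// /series /= -sumEFin.
  by apply: nneseries_lim_ge => n _ _; rewrite lee_fin.
pose D := [set x | G x \is a fin_num].
have mD : measurable D.
  by rewrite -[D]setTI; exact: (emeasurable_fin_num measurableT mG).
(* Cutting off outside the set where G is finite makes the partial sums converge at every point, so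
   that the limit is measurable. *)
pose S' N x := (\sum_(n < N) h n x) * \1_D x.
pose g x := limn (S' ^~ x).
have cS' x : S' ^~ x @ \oo --> g x.
  rewrite /g /S' indicE; case: (asboolP (G x \is a fin_num)) => Dx.
    rewrite mem_set//; under eq_fun do rewrite mulr1; exact: cvgS.
  rewrite memNset//; under eq_fun do rewrite mulr0; exact: is_cvg_cst.
have mg : measurable_fun setT g.
  apply: (@measurable_fun_cvg _ _ _ setT S') => [N|x _]; last exact: cS'.
  by apply: measurable_funM => //; exact: measurable_sum.
have key (phi : X -> R) : measurable_fun setT phi -> (forall x, `|phi x| <= 1) ->
    m.-integrable setT (EFin \o (fun x => g x * phi x)) /\
    (fun N => \sum_(n < N) Rintegral m setT (fun x => h n x * phi x)) @ \oo
        --> Rintegral m setT (fun x => g x * phi x).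
  move=> mphi phi1.
  have hphi n := integrableM_bounded (hi n) mphi phi1.
  have [|||||i1 _ i3] := @dominated_convergence _ _ _ m setT measurableT
    (fun N x => (((\sum_(n < N) h n x) * phi x)%:E))
    (fun x => (g x * phi x)%:E) G.
  - by move=> N; apply/measurable_EFinP/measurable_funM => //; exact: measurable_sum.
  - exact/measurable_EFinP/measurable_funM.
  - have := integrable_ae measurableT iG; apply: filterS => x /(_ I) Gx _.
    apply: cvg_EFin; first by apply: nearW.
    apply: cvgM; last exact: cvg_cst.
    have := cS' x; rewrite /S' indicE mem_set//.
    by under eq_fun do rewrite mulr1.
  - exact: iG.
  - apply/aeW => x N _; apply: le_trans (SG N x).
    by rewrite abse_EFin lee_fin normrM ler_piMr.
  split => //.
  have igphi := integrable_fin_num measurableT i1.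
  have -> : (fun N => \sum_(n < N) Rintegral m setT (fun x => h n x * phi x)) =
    fine \o (fun N => \int[m]_x ((\sum_(n < N) h n x) * phi x)%:E)%E.
    apply/funext => N /=.
    under eq_integral do rewrite big_distrl /= -sumEFin.
    rewrite (integral_sum measurableT (fun n : 'I_N => hphi n)).
    rewrite -sum_fine// => n _.
    exact: (integrable_fin_num measurableT (hphi n)).
  by apply: fine_cvg; rewrite fineK.
(* Integrability of the limit itself is the case of the constant test function 1. *)
exists g; last by move=> phi mp p1; case: (key phi mp p1).
have [|x|i1 _] := key (cst 1); [exact: measurable_cst|by rewrite normr1|].
by apply: eq_integrable i1 => // x _ /=; rewrite mulr1.
Qed.

End L1Series.

(** * Trigonometric polynomials: coefficients, Parseval identity, L^1 bound *)

Section Parseval.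
Context {R : realType} {d : nat}.
Implicit Types (c : freq d -> R[i]) (s : seq (freq d)).

Definition trig_poly c s : torus R d -> R[i] :=
  fun x => \sum_(k <- s) c k * expi (dotk k x).

Lemma cintegrable_trig_poly c s : integrable_torus (trig_poly c s).
Proof.
apply: cintegrable_sum => k; apply: cintegrableZ.
exact/unit_bounded_cintegrable/unit_bounded_expi_dotk.
Qed.

Lemma fourier_trig_poly c s k : uniq s ->
  fourier (trig_poly c s) k = if k \in s then c k else 0.
Proof.
move=> us; rewrite /fourier /trig_poly.
under [X in cintegral _ _ X]funext do rewrite big_distrl /=.
rewrite cintegral_sum => [|l]; last first.
  apply: cintegrableM (unit_bounded_expi_Ndotk k); apply: cintegrableZ.
  exact/unit_bounded_cintegrable/unit_bounded_expi_dotk.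
transitivity (\sum_(l <- s) c l * (l == k)%:R).
  apply: eq_bigr => l _.
  under [X in cintegral _ _ X]funext do rewrite -mulrA.
  rewrite cintegralZ; first by rewrite -fourier_expi.
  apply: cintegrableM (unit_bounded_expi_Ndotk k).
  exact/unit_bounded_cintegrable/unit_bounded_expi_dotk.
case: ifPn => ks.
  rewrite (bigD1_seq k)//= eqxx mulr1 big1 ?addr0// => l /negbTE ->.
  by rewrite mulr0.
rewrite big_seq big1// => l ls; case: eqP => [lk|_]; last by rewrite mulr0.
by rewrite -lk ls in ks.
Qed.

Lemma complexRe_sum (I : Type) (r : seq I) (F : I -> R[i]) :
  complex.Re (\sum_(i <- r) F i) = \sum_(i <- r) complex.Re (F i).
Proof.
elim: r => [|i r IH]; first by rewrite !big_nil.
by rewrite !big_cons complexReD IH.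
Qed.

Lemma complexIm_sum (I : Type) (r : seq I) (F : I -> R[i]) :
  complex.Im (\sum_(i <- r) F i) = \sum_(i <- r) complex.Im (F i).
Proof.
elim: r => [|i r IH]; first by rewrite !big_nil.
by rewrite !big_cons complexImD IH.
Qed.

Lemma conjc_expi (a : R) : conjc (expi a) = expi (- a).
Proof. by rewrite /expi cosN sinN. Qed.

Lemma Re_mul_conjc (z : R[i]) :
  complex.Re (conjc z * z) = Normc.normc z ^+ 2 :> R.
Proof. by case: z => a b; rewrite normc_sqrE /= -!expr2; ring. Qed.

(** Expanding only the conjugate factor of |q|^2, for q the polynomial, gives |q|^2 = Re sum_k
    conj(c_k) q e^{-ik.x}. Integrating term by term leaves conj(c_k) times the k-th Fourier
    coefficient of q, which is c_k. *)
Lemma trig_poly_parseval c s : uniq s ->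
  (torus_prob d).-integrable setT
    (EFin \o (fun x => Normc.normc (trig_poly c s x) ^+ 2)) /\
  Rintegral (torus_prob d) setT
    (fun x => Normc.normc (trig_poly c s x) ^+ 2) =
  \sum_(k <- s) Normc.normc (c k) ^+ 2.
Proof.
move=> us.
pose P := fun x : torus R d =>
  \sum_(k <- s) conjc (c k) * (trig_poly c s x * expi (- dotk k x)).
have iP0 k : integrable_torus (fun x => trig_poly c s x * expi (- dotk k x)).
  exact: cintegrableM (cintegrable_trig_poly c s) (unit_bounded_expi_Ndotk k).
have iP : integrable_torus P by apply: cintegrable_sum => k; exact: cintegrableZ (iP0 k).
have PE x : Normc.normc (trig_poly c s x) ^+ 2 = complex.Re (P x).
  have E : conjc (trig_poly c s x) =
      \sum_(k <- s) conjc (c k) * expi (- dotk k x).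
    rewrite /trig_poly; elim: s {us P iP0 iP} => [|k s IH].
      by rewrite !big_nil; exact: rmorph0.
    rewrite !big_cons -IH; set u := (X in _ + X).
    by rewrite -conjc_expi -[conjc (c k) * _]rmorphM; exact: rmorphD.
  rewrite -Re_mul_conjc E big_distrl /=.
  congr (complex.Re _); apply: eq_bigr => k _.
  by rewrite -mulrA [expi _ * _]mulrC.
split.
  by apply: eq_integrable (iP.1) => // x _ /=; rewrite PE.
under eq_Rintegral do rewrite PE.
rewrite -[LHS]/(complex.Re (cintegral (torus_prob d) setT P)).
rewrite cintegral_sum => [|k]; last exact: cintegrableZ (iP0 k).
rewrite complexRe_sum big_seq [RHS]big_seq; apply: eq_bigr => k ks.
rewrite (cintegralZ _ (iP0 k)) -[X in _ * X]/(fourier (trig_poly c s) k).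
by rewrite fourier_trig_poly// ks Re_mul_conjc.
Qed.

(* AM-GM replaces the Cauchy-Schwarz inequality. *)
Lemma trig_poly_L1 c s (f : torus R d -> R) (e A : R) : 0 < e -> uniq s ->
  (torus_prob d).-integrable setT (EFin \o f) ->
  (forall x, f x ^+ 2 <= Normc.normc (trig_poly c s x) ^+ 2) ->
  \sum_(k <- s) Normc.normc (c k) ^+ 2 <= A * e ^+ 2 ->
  (\int[torus_prob d]_x (`|f x|)%:E <= ((1 + A) * e)%:E)%E.
Proof.
move=> e0 us fi fle sA; have [i1 e1] := trig_poly_parseval c us.
have ai := integrable_norm fi.
rewrite -[leLHS](@fineK _ (\int[torus_prob d]_x `|f x|%:E)%E); last exact: (integrable_fin_num measurableT ai).
rewrite lee_fin.
have i2 : (torus_prob d).-integrable setT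
    (EFin \o (fun x => e^-1 * Normc.normc (trig_poly c s x) ^+ 2)).
  exact: (integrableZl _ e^-1 i1).
have i3 : (torus_prob d).-integrable setT (EFin \o (cst e)).
  exact: (finite_measure_integrable_cst (torus_prob d) e).
apply: (@le_trans _ _ (Rintegral (torus_prob d) setT
    (fun x => e + e^-1 * Normc.normc (trig_poly c s x) ^+ 2))).
  apply: le_Rintegral => // [|x _]; first exact: (integrableD _ i3 i2).
  have := fle x; set y := Normc.normc _ => fy.
  rewrite -(ler_pM2l e0) mulrDr mulrA divff ?gt_eqF// mul1r -expr2.
  apply: le_trans (lerD (lexx _) fy).
  have -> : f x ^+ 2 = `|f x| ^+ 2 by rewrite real_normK// num_real.
  have := sqr_ge0 (e - `|f x|); have := sqr_ge0 e; have := sqr_ge0 `|f x|; nra.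
rewrite RintegralD// Rintegral_prob_cst RintegralZl// e1.
rewrite mulrDl mul1r lerD2l -(ler_pM2l e0) mulrA divff ?gt_eqF// mul1r.
by apply: le_trans sA _; rewrite expr2 mulrCA.
Qed.

End Parseval.

(** * Splitting a summable family into finite blocks of geometrically small mass *)

Section FiniteExhaustion.
Context {R : realType} {I : choiceType} (a : I -> R).
Hypotheses (a0 : forall i, 0 <= a i)
  (afin : (\esum_(i in [set: I]) (a i)%:E < +oo)%E).

Let S := fine (\esum_(i in [set: I]) (a i)%:E).

Let SE : (S%:E = \esum_(i in [set: I]) (a i)%:E)%E.
Proof.
rewrite fineK// ge0_fin_numE// esum_ge0// => i _.
by rewrite lee_fin.
Qed.

Let sum_le_S (A : {fset I}) : \sum_(i <- A) a i <= S.
Proof.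
rewrite -lee_fin SE; apply: esum_ge; exists [set` A].
  by split; [exact: finite_fset|].
by rewrite fsbig_finite//= set_fsetK sumEFin.
Qed.

Let sum_ge_S (e : R) : 0 < e ->
  exists A : {fset I}, S - e <= \sum_(i <- A) a i.
Proof.
move=> e0.
have fe : (\esum_(i in [set: I]) (a i)%:E)%E \is a fin_num by rewrite -SE.
have [x [A [Afin _] <-]] := ub_ereal_sup_adherent e0 fe.
rewrite -/(esum _ _) -SE fsbig_finite//= sumEFin -EFinB lte_fin => /ltW SA.
by exists (fset_set A).
Qed.

Let sum_fsetU (F A : {fset I}) : \sum_(i <- (F `|` A)%fset) a i =
  \sum_(i <- F) a i + \sum_(i <- (A `\` F)%fset) a i.
Proof.
rewrite -big_cat; apply/perm_big/uniq_perm => //.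
  rewrite cat_uniq !fset_uniq andbT /=; apply/hasPn => i.
  by rewrite in_fsetD => /andP[].
by move=> i; rewrite mem_cat in_fsetU in_fsetD; case: (i \in F).
Qed.

(** [F n.+1] contains a finite set that carries all of the total [S] except K 4^-(n+2), so whatever
    is added afterwards has at most that mass. An index that stays outside every [F n] would have a
    term below each of these remainders, hence a zero term. *)
Lemma finite_exhaustion : exists (B F : nat -> {fset I}) (K : R),
  [/\ F 0%N = fset0 /\ forall n, F n.+1 = (F n `|` B n)%fset,
      forall n, [disjoint B n & F n]%fset,
      forall n, \sum_(i <- B n) a i <= K * (1 / (2 ^ n.+1)%:R) ^+ 2 &
      forall i, a i != 0 -> exists N, forall n, (N <= n)%N -> i \in F n].
Proof.
(* The first block is only known to have mass at most [S]; the factor 4 makes its allowance K / 4 =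
   S + 1. The added 1 keeps [K] positive when [S] vanishes. *)
pose K := 4 * (S + 1).
have S0 : 0 <= S by have := sum_le_S fset0; rewrite big_seq_fset0.
have K0 : 0 < K by rewrite /K; lra.
pose r n : R := 1 / (2 ^ n.+1)%:R.
have r0 n : 0 < r n by rewrite divr_gt0// ltr0n expn_gt0.
have Kr0 n : 0 < K * r n ^+ 2 by rewrite mulr_gt0// exprn_gt0.
have [A AP] := choice (fun n => sum_ge_S (Kr0 n.+1)).
pose F := fix F n := if n is m.+1 then (F m `|` A m)%fset else fset0.
have FS n : \sum_(i <- A n) a i <= \sum_(i <- F n.+1) a i.
  by rewrite /= fsetUC sum_fsetU lerDl sumr_ge0.
exists (fun n => (A n `\` F n)%fset), F, K; split.
- split => // n /=; apply/fsetP => i; rewrite !in_fsetU in_fsetD.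
  by case: (i \in F n).
- by move=> n; apply/fdisjointP => i; rewrite in_fsetD => /andP[].
- case=> [|n].
    apply: le_trans (sum_le_S _) _.
    have -> : K * (1 / (2 ^ 1)%:R) ^+ 2 = S + 1 by rewrite expn1 /K; field.
    by rewrite lerDl.
  have := sum_le_S (F n.+1 `|` A n.+1)%fset; rewrite sum_fsetU.
  have := le_trans (AP n) (FS n); rewrite -/(r n.+1); lra.
- move=> i ai0; have ai : 0 < a i by rewrite lt_neqAle eq_sym ai0 a0.
  have Fmono m n : (m <= n)%N -> i \in F m -> i \in F n.
    move=> /subnK <-; elim: (n - m)%N => // k IH im.
    by rewrite addSn /= in_fsetU IH.
  suff [n iF] : exists n, i \in F n by exists n => m nm; exact: Fmono iF.
  apply: contrapT => /forallNP noF.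
  have le n : a i <= K * r n.+1 ^+ 2.
    have := sum_le_S (F n.+1 `|` [fset i])%fset; rewrite sum_fsetU.
    have -> : ([fset i] `\` F n.+1 = [fset i])%fset.
      apply/fsetP => j; rewrite in_fsetD in_fset1; case: eqP => [->|_].
        by rewrite andbT; apply/negP/noF.
      by rewrite andbF.
    rewrite big_seq_fset1; have := le_trans (AP n) (FS n); lra.
  (* An integer above K / a_i; since r_{n+1}^2 <= 1/n, the bound [le] at this [n] forces a_i <
     a_i. *)
  pose n := (Num.truncn (K / a i)).+1.
  have nK : K / a i < n%:R by exact: truncnS_gt.
  have rn : r n.+1 ^+ 2 <= n%:R^-1.
    have n0 : 0 < n%:R :> R by rewrite ltr0n.
    have r1 : r n.+1 <= n%:R^-1.
      rewrite /r div1r lef_pV2 ?posrE ?ltr0n ?expn_gt0//.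
      by rewrite ler_nat (leq_trans _ (ltnW (ltn_expl n.+2 (ltnSn 1))))// -addn2 leq_addr.
    have r2 : r n.+1 <= 1 by rewrite (le_trans r1)// invf_le1// ler1n.
    by rewrite expr2 (le_trans _ r1)// ler_piMl// ltW.
  have : K * r n.+1 ^+ 2 <= K / n%:R by rewrite ler_pM2l.
  move=> /(le_trans (le n)); apply/negP; rewrite -ltNge.
  rewrite ltr_pdivrMr ?ltr0n//.
  by move: nK; rewrite ltr_pdivrMr// mulrC.
Qed.

End FiniteExhaustion.

(** * The Riesz-Fischer theorem on the torus *)

Section RieszFischer.
Context {R : realType} {d : nat}.
Local Notation mu := (torus_prob d : probability (torus R d) R).

Lemma sqr_Re_le_normc (z : R[i]) : complex.Re z ^+ 2 <= Normc.normc z ^+ 2.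
Proof. by rewrite normc_sqrE lerDl sqr_ge0. Qed.

Lemma sqr_Im_le_normc (z : R[i]) : complex.Im z ^+ 2 <= Normc.normc z ^+ 2.
Proof. by rewrite normc_sqrE lerDr sqr_ge0. Qed.

(** The partial sums are grouped along the blocks of [finite_exhaustion]: the block sums are then
    summable in L^1, and [L1_series] is applied to their real and imaginary parts. *)
Lemma riesz_fischer (c : freq d -> R[i]) :
  (\esum_(k in [set: freq d]) (Normc.normc (c k) ^+ 2)%:E < +oo)%E ->
  exists2 g : torus R d -> R[i], integrable_torus g &
    forall k, fourier g k = c k.
Proof.
move=> cfin.
have [B [F [K [[F0 FS] BF sB FN]]]] :=
  finite_exhaustion (fun k => sqr_ge0 (Normc.normc (c k))) cfin.
pose h n := trig_poly c (B n) : torus R d -> R[i].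
have hi n : integrable_torus (h n) by exact: cintegrable_trig_poly.
have sum_lty (f : nat -> torus R d -> R) :
    (forall n, mu.-integrable setT (EFin \o f n)) ->
    (forall n x, f n x ^+ 2 <= Normc.normc (h n x) ^+ 2) ->
    (\sum_(0 <= n <oo) \int[mu]_x (`|f n x|)%:E < +oo)%E.
  move=> fi fh.
  apply: (@le_lt_trans _ _
      (\sum_(0 <= n <oo) ((1 + K) / (2 ^ (n + 1))%:R)%:E)%E); last first.
    rewrite (cvg_lim _ (@cvg_geometric_eseries_half _ (1 + K) 0))//.
    by rewrite ltry.
  apply: lee_nneseries => [n _ _|n _].
    by apply: integral_ge0 => x _; rewrite lee_fin.
  (* Block [n] has square mass at most K e^2 with e = 2^-(n+1), hence L^1 norm at most (1 + K) e, a
     summable bound. *)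
  have := @trig_poly_L1 _ _ c (B n) (f n) (1 / (2 ^ n.+1)%:R) K.
  by rewrite addn1 [(1 + K) * _]mulrA mulr1; apply => //; exact: fset_uniq.
have [gR gRi gRc] := L1_series (fun n => (hi n).1)
  (sum_lty _ (fun n => (hi n).1) (fun n x => sqr_Re_le_normc (h n x))).
have [gI gIi gIc] := L1_series (fun n => (hi n).2)
  (sum_lty _ (fun n => (hi n).2) (fun n x => sqr_Im_le_normc (h n x))).
pose g x : R[i] := Complex (gR x) (gI x).
have gi : integrable_torus g by [].
exists g => // k.
have [mc ms b1] := @unit_bounded_expi_Ndotk R _ k.
have b1c x := (b1 x).1; have b1s x := (b1 x).2.
have hsum N : \sum_(n < N) fourier (h n) k = if k \in F N then c k else 0.
  elim: N => [|N IH]; first by rewrite big_ord0 F0 in_fset0.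
  rewrite big_ord_recr /= IH fourier_trig_poly ?fset_uniq// FS in_fsetU.
  case: ifPn => kF; case: ifPn => kB; rewrite ?addr0 ?add0r//.
  by have /fdisjointP/(_ _ kB) := BF N; rewrite kF.
(* The coefficient sums are eventually constant. A frequency with c_k = 0 need not enter any [F N],
   but both branches of [hsum] then give 0. *)
have hlim : exists N0, forall N, (N0 <= N)%N -> \sum_(n < N) fourier (h n) k = c k.
  have [ck|ck] := eqVneq (Normc.normc (c k) ^+ 2) 0.
    exists 0%N => N _; rewrite hsum; case: ifP => // _; apply/esym.
    by apply: Normc.eq0_normc; apply/eqP; rewrite -sqrf_eq0 ck.
  have [N0 N0P] := FN _ ck; exists N0 => N N0N.
  by rewrite hsum N0P.
have [N0 N0P] := hlim.
have Iprod (f phi : torus R d -> R) := @integrableM_bounded _ _ _ mu f phi.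
have lim_unique (v : nat -> R) (l l' : R) : v @ \oo --> l ->
    (forall N, (N0 <= N)%N -> v N = l') -> l = l'.
  move=> vl vl'; apply: cvg_unique vl _ => //.
  by apply: cvg_near_cst; exists N0 => // N /= /vl' ->.
(* The two parts of e^{-ik.x} are the bounded test functions, so each part of the k-th coefficient
   is a combination of two limits given by [L1_series]. *)
apply: complex_ext.
- have := cvgB (gRc _ mc b1c) (gIc _ ms b1s).
  rewrite -RintegralB//; [|exact: Iprod|exact: Iprod].
  rewrite /fourier /= (@eq_Rintegral _ _ _ mu setT (fun x => gR x * cos (- dotk k x) - gI x * sin (- dotk k x)))//.
  move=> /(_ _) H; apply: lim_unique H _ => N /N0P <-.
  rewrite complexRe_sum -[LHS]sumrB; apply: eq_bigr => n _.
  rewrite -RintegralB//; [|exact: (Iprod _ _ (hi n).1)|exact: (Iprod _ _ (hi n).2)].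
  by rewrite /fourier /=; apply: eq_Rintegral => x _; rewrite complexReM.
- have := cvgD (gRc _ ms b1s) (gIc _ mc b1c).
  rewrite -RintegralD//; [|exact: Iprod|exact: Iprod].
  rewrite /fourier /= (@eq_Rintegral _ _ _ mu setT (fun x => gR x * sin (- dotk k x) + gI x * cos (- dotk k x)))//.
  move=> /(_ _) H; apply: lim_unique H _ => N /N0P <-.
  rewrite complexIm_sum -[LHS]big_split; apply: eq_bigr => n _.
  rewrite -[LHS]RintegralD//; [|exact: (Iprod _ _ (hi n).1)|exact: (Iprod _ _ (hi n).2)].
  by rewrite /fourier /=; apply: eq_Rintegral => x _; rewrite complexImM.
Qed.

End RieszFischer.

(** * Minkowski inequality for sums over an arbitrary index type *)

Section Minkowski.
Context {R : realType} {I : choiceType}.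
Implicit Types P Q S : I -> R.

Lemma esumZ_le (c : R) P : 0 <= c -> (forall i, 0 <= P i) ->
  (\esum_(i in [set: I]) (c * P i)%:E <= c%:E * \esum_(i in [set: I]) (P i)%:E)%E.
Proof.
move=> c0 P0; apply: ub_ereal_sup => _ [F [Ffin _] <-].
rewrite fsbig_finite//= sumEFin -mulr_sumr EFinM.
apply: lee_wpmul2l; first by rewrite lee_fin.
apply: esum_ge; exists F => //.
by rewrite fsbig_finite//= sumEFin.
Qed.

(** The termwise hypothesis is Young's inequality for every weight [t]. Summing it and then choosing
    t close to sqrt(B / A), with A and B the two sums, gives (sqrt A + sqrt B)^2. *)
Lemma esum_minkowski P Q S :
  (forall i, 0 <= P i) -> (forall i, 0 <= Q i) -> (forall i, 0 <= S i) ->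
  (forall i t, 0 < t -> S i <= (1 + t) * P i + (1 + t^-1) * Q i) ->
  (sqrte (\esum_(i in [set: I]) (S i)%:E) <=
   sqrte (\esum_(i in [set: I]) (P i)%:E) +
   sqrte (\esum_(i in [set: I]) (Q i)%:E))%E.
Proof.
move=> P0 Q0 S0 SPQ.
have eP0 : (0 <= \esum_(i in [set: I]) (P i)%:E)%E.
  by apply: esum_ge0 => i _; rewrite lee_fin.
have eQ0 : (0 <= \esum_(i in [set: I]) (Q i)%:E)%E.
  by apply: esum_ge0 => i _; rewrite lee_fin.
have le_t t : 0 < t -> (\esum_(i in [set: I]) (S i)%:E <=
    (1 + t)%:E * (\esum_(i in [set: I]) (P i)%:E) +
    (1 + t^-1)%:E * (\esum_(i in [set: I]) (Q i)%:E))%E.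
  move=> t0; have t1 : 0 <= 1 + t by rewrite addr_ge0// ltW.
  have t2 : 0 <= 1 + t^-1 by rewrite addr_ge0// invr_ge0 ltW.
  apply: (@le_trans _ _ (\esum_(i in [set: I]) ((1 + t) * P i)%:E +
    \esum_(i in [set: I]) ((1 + t^-1) * Q i)%:E)%E); last first.
    by apply: leeD; exact: esumZ_le.
  rewrite -esumD; last 2 first.
  - by move=> i _; rewrite lee_fin mulr_ge0.
  - by move=> i _; rewrite lee_fin mulr_ge0.
  by apply: le_esum => i _; rewrite -EFinD lee_fin; exact: SPQ.
case: (\esum_(i in [set: I]) (P i)%:E)%E eP0 le_t => [A| |//] A0 le_t; last first.
  by rewrite addye ?leey// gt_eqF// (lt_le_trans _ (sqrte_ge0 _)).
case: (\esum_(i in [set: I]) (Q i)%:E)%E eQ0 le_t => [B| |//] B0 le_t; last first.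
  by rewrite addey ?leey// gt_eqF// (lt_le_trans _ (sqrte_ge0 _)).
rewrite !lee_fin in A0 B0.
apply/lee_addgt0Pr => e e0 /=; rewrite -!EFinD.
(* The shift by e / 2 makes be / al a legitimate weight even when [A] or [B] is zero. *)
pose al := Num.sqrt A + e / 2; pose be := Num.sqrt B + e / 2.
have sA := sqrtr_ge0 A; have sB := sqrtr_ge0 B.
have al0 : 0 < al by rewrite /al; lra.
have be0 : 0 < be by rewrite /be; lra.
have Aal : A <= al ^+ 2.
  by rewrite -{1}(sqr_sqrtr A0) lerXn2r ?nnegrE ?(ltW al0)// /al; lra.
have Bbe : B <= be ^+ 2.
  by rewrite -{1}(sqr_sqrtr B0) lerXn2r ?nnegrE ?(ltW be0)// /be; lra.
have -> : Num.sqrt A + Num.sqrt B + e = al + be by rewrite /al /be; field.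
have -> : (al + be)%:E = sqrte (((al + be) ^+ 2)%:E).
  by rewrite /= sqrtr_sqr ger0_norm// addr_ge0 ?ltW.
rewrite lee_sqrt ?lee_fin ?sqr_ge0//.
apply: le_trans (le_t (be / al) (divr_gt0 be0 al0)) _.
rewrite -!EFinM -EFinD lee_fin invf_div.
have -> : (al + be) ^+ 2 = (1 + be / al) * al ^+ 2 + (1 + al / be) * be ^+ 2.
  by field; rewrite !gt_eqF.
by apply: lerD; apply: ler_wpM2l => //; rewrite addr_ge0// divr_ge0// ltW.
Qed.

End Minkowski.

(** * Sobolev norms and the free Schroedinger group *)

Section SobolevNorm.
Context {R : realType} {d : nat}.
Implicit Types (f g : torus R d -> R[i]) (a : R) (k : freq d).

(** Young's inequality in the form that [esum_minkowski] asks for; the defect in each component is a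
    square divided by [t]. *)
Lemma normcD_sqr_le (z w : R[i]) (t : R) : 0 < t ->
  Normc.normc (z + w) ^+ 2 <=
  (1 + t) * Normc.normc z ^+ 2 + (1 + t^-1) * Normc.normc w ^+ 2.
Proof.
move=> t0; rewrite !normc_sqrE complexReD complexImD.
have H (x y : R) : (x + y) ^+ 2 <= (1 + t) * x ^+ 2 + (1 + t^-1) * y ^+ 2.
  rewrite -subr_ge0.
  have -> : (1 + t) * x ^+ 2 + (1 + t^-1) * y ^+ 2 - (x + y) ^+ 2 =
    t^-1 * (t * x - y) ^+ 2 by field; rewrite gt_eqF.
  by rewrite mulr_ge0 ?sqr_ge0// invr_ge0 ltW.
have := H (complex.Re z) (complex.Re w); have := H (complex.Im z) (complex.Im w).
lra.
Qed.

Lemma integrable_torusD f g : integrable_torus f -> integrable_torus g ->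
  integrable_torus (f \+ g).
Proof. exact: cintegrableD. Qed.

Lemma integrable_torusN f : integrable_torus f -> integrable_torus (\- f).
Proof.
move=> fi; have := cintegrableZ (-1) fi.
by congr integrable_torus; apply/funext => x /=; rewrite mulN1r.
Qed.

Lemma integrable_torusB f g : integrable_torus f -> integrable_torus g ->
  integrable_torus (f \- g).
Proof. by move=> fi /integrable_torusN; exact: integrable_torusD. Qed.

Lemma fourierD f g k : integrable_torus f -> integrable_torus g ->
  fourier (f \+ g) k = fourier f k + fourier g k.
Proof.
move=> fi gi; rewrite /fourier -cintegralD; last 2 first.
- exact: cintegrableM fi (unit_bounded_expi_Ndotk k).
- exact: cintegrableM gi (unit_bounded_expi_Ndotk k).
by congr cintegral; apply/funext => x /=; rewrite mulrDl.
Qed.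

Lemma fourierN f k : integrable_torus f -> fourier (\- f) k = - fourier f k.
Proof.
move=> fi; rewrite /fourier -mulN1r -cintegralZ; last first.
  exact: cintegrableM fi (unit_bounded_expi_Ndotk k).
by congr cintegral; apply/funext => x /=; rewrite mulN1r mulNr.
Qed.

Lemma fourierB f g k : integrable_torus f -> integrable_torus g ->
  fourier (f \- g) k = fourier f k - fourier g k.
Proof.
by move=> fi gi; rewrite -fourierN// -fourierD//; exact: integrable_torusN.
Qed.

Lemma sqrk_ge0 k : 0 <= sqrk k :> R.
Proof. by apply: sumr_ge0 => j _; exact: sqr_ge0. Qed.

Lemma sobolev_weight_ge1 a k : 0 <= a -> 1 <= (1 + sqrk k) `^ a :> R.
Proof.
move=> a0; rewrite -[leLHS](powRr0 (1 + sqrk k)) ler_powR//.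
by rewrite lerDl sqrk_ge0.
Qed.

Lemma sobolev_term_ge0 a (c : freq d -> R[i]) k :
  0 <= (1 + sqrk k) `^ a * Normc.normc (c k) ^+ 2.
Proof. by rewrite mulr_ge0 ?powR_ge0 ?sqr_ge0. Qed.

Lemma Hnorm_ge0 a f : (0 <= Hnorm a f)%E. Proof. exact: sqrte_ge0. Qed.

Lemma eq_Hnorm a f g :
  (forall k, Normc.normc (fourier f k) = Normc.normc (fourier g k)) ->
  Hnorm a f = Hnorm a g.
Proof.
by move=> fg; congr sqrte; apply: eq_esum => k _; rewrite fg.
Qed.

Lemma HnormD a f g : integrable_torus f -> integrable_torus g ->
  (Hnorm a (f \+ g) <= Hnorm a f + Hnorm a g)%E.
Proof.
move=> fi gi; apply: esum_minkowski => [k|k|k|k t t0].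
- exact: sobolev_term_ge0.
- exact: sobolev_term_ge0.
- exact: sobolev_term_ge0.
rewrite fourierD// !(mulrCA _ (_ `^ a)) -mulrDr ler_wpM2l ?powR_ge0//.
exact: normcD_sqr_le.
Qed.

Lemma HnormN a f : integrable_torus f -> Hnorm a (\- f) = Hnorm a f.
Proof.
by move=> fi; apply: eq_Hnorm => k; rewrite fourierN// (normcN (fourier f k : Rcomplex R)).
Qed.

Lemma HnormB a f g : integrable_torus f -> integrable_torus g ->
  (Hnorm a (f \- g) <= Hnorm a f + Hnorm a g)%E.
Proof.
move=> fi gi; rewrite -(HnormN a gi).
exact: HnormD fi (integrable_torusN gi).
Qed.

Lemma HspaceD a f g : Hspace a f -> Hspace a g -> Hspace a (f \+ g).
Proof.
move=> [fi fa] [gi ga]; split; first exact: integrable_torusD.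
by apply: le_lt_trans (HnormD a fi gi) _; exact: (lte_add_pinfty fa ga).
Qed.

Lemma HspaceB a f g : Hspace a f -> Hspace a g -> Hspace a (f \- g).
Proof.
move=> [fi fa] [gi ga]; split; first exact: integrable_torusB.
by apply: le_lt_trans (HnormB a fi gi) _; exact: (lte_add_pinfty fa ga).
Qed.

Lemma Hnorm_fineK a f : Hspace a f -> (fine (Hnorm a f))%:E = Hnorm a f.
Proof. by move=> [_ fa]; rewrite fineK// ge0_fin_numE// Hnorm_ge0. Qed.

Lemma le_Hnorm a b f : a <= b -> (Hnorm a f <= Hnorm b f)%E.
Proof.
move=> ab; rewrite /Hnorm lee_sqrt; last first.
  by apply: esum_ge0 => k _; rewrite lee_fin sobolev_term_ge0.
apply: le_esum => k _; rewrite lee_fin ler_wpM2r ?sqr_ge0//.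
by rewrite ler_powR// lerDl sqrk_ge0.
Qed.

(** [fourier_multiplier] picks a function by choice and returns 0 if there is none, so existence has
    to be shown first. For a >= 0 the Sobolev weights are at least 1, hence the rotated coefficients
    are square summable and [riesz_fischer] applies. *)
Lemma schroedingerP a t f : 0 <= a -> Hspace a f ->
  integrable_torus (schroedinger t f) /\
  forall k, fourier (schroedinger t f) k =
    expi (- (t * sqrk k)) * fourier f k.
Proof.
move=> a0 [fi fa].
pose c k := expi (- (t * sqrk k)) * fourier f k.
have cfin : (\esum_(k in [set: freq d]) (Normc.normc (c k) ^+ 2)%:E < +oo)%E.
  apply: (@le_lt_trans _ _ (\esum_(k in [set: freq d])
      ((1 + sqrk k) `^ a * Normc.normc (fourier f k) ^+ 2)%:E)%E).
    apply: le_esum => k _; rewrite lee_fin Normc.normcM normc_expi mul1r.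
    by rewrite ler_peMl ?sqr_ge0 ?sobolev_weight_ge1.
  rewrite ltNge; apply/negP; rewrite leye_eq => /eqP E.
  by move: fa; rewrite /Hnorm E.
have [g gi gc] := riesz_fischer cfin.
have := @xgetPex _ (cst 0) [set g0 | integrable_torus g0 /\
  forall k, fourier g0 k = c k] (ex_intro _ g (conj gi gc)).
by [].
Qed.

Lemma Hnorm_schroedinger a t f : 0 <= a -> Hspace a f ->
  Hnorm a (schroedinger t f) = Hnorm a f.
Proof.
move=> a0 fa; have [_ E] := schroedingerP t a0 fa.
by apply: eq_Hnorm => k; rewrite E Normc.normcM normc_expi mul1r.
Qed.

Lemma Hspace_schroedinger a t f : 0 <= a -> Hspace a f ->
  Hspace a (schroedinger t f).
Proof.
move=> a0 fa; split; first by case: (schroedingerP t a0 fa).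
by rewrite Hnorm_schroedinger//; case: fa.
Qed.

Lemma fourier_schroedinger a t f k : 0 <= a -> Hspace a f ->
  fourier (schroedinger t f) k = expi (- (t * sqrk k)) * fourier f k.
Proof. by move=> a0 fa; have [] := schroedingerP t a0 fa. Qed.

End SobolevNorm.

(** * The error recursion of the two-step scheme *)

Section ErrorRecursion.
Context {R : realType} {d : nat}.

Lemma two_step_error a tau (x0 x1 x2 y0 A0 B0 A1 B1 : torus R d -> R[i]) :
  0 <= a ->
  Hspace a x0 -> Hspace a x1 -> Hspace a x2 -> Hspace a y0 ->
  Hspace a A0 -> Hspace a B0 -> Hspace a A1 -> Hspace a B1 ->
  (Hnorm a (x2 \- ((schroedinger (2 * tau) y0 \+ A1)
                   \- schroedinger (2 * tau) B1))%R <=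
   Hnorm a (x0 \- y0)%R + Hnorm a (A0 \- A1)%R + Hnorm a (B0 \- B1)%R +
   Hnorm a ((x2 \- (schroedinger tau x1 \+ A0))
     \- schroedinger (2 * tau) (x0 \- (schroedinger (- tau) x1 \+ B0)))%R)%E.
Proof.
move=> a0 hx0 hx1 hx2 hy0 hA0 hB0 hA1 hB1.
have hS t (f : torus R d -> R[i]) : Hspace a f -> Hspace a (schroedinger t f).
  exact: Hspace_schroedinger.
pose E := schroedinger (2 * tau) (x0 \- y0).
pose L := (A0 \- A1) \- schroedinger (2 * tau) (B0 \- B1).
pose Rp := x2 \- (schroedinger tau x1 \+ A0).
pose Rm := x0 \- (schroedinger (- tau) x1 \+ B0).
have hRp : Hspace a Rp := HspaceB hx2 (HspaceD (hS _ _ hx1) hA0).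
have hRm : Hspace a Rm := HspaceB hx0 (HspaceD (hS _ _ hx1) hB0).
have hE : Hspace a E := hS _ _ (HspaceB hx0 hy0).
have hLA : Hspace a (A0 \- A1) := HspaceB hA0 hA1.
have hLB : Hspace a (B0 \- B1) := HspaceB hB0 hB1.
have hL : Hspace a L := HspaceB hLA (hS _ _ hLB).
have hRR : Hspace a (Rp \- schroedinger (2 * tau) Rm) := HspaceB hRp (hS _ _ hRm).
(* The decomposition is checked on Fourier coefficients, because [schroedinger] returns a chosen
   representative and need not be linear pointwise. *)
rewrite (@eq_Hnorm _ _ a _ ((E \+ L) \+ (Rp \- schroedinger (2 * tau) Rm))); last first.
  move=> k; congr Normc.normc.
  have FD (f g : torus R d -> R[i]) : Hspace a f -> Hspace a g ->
      fourier (f \+ g) k = fourier f k + fourier g k.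
    by move=> [fi _] [gi _]; exact: fourierD.
  have FB (f g : torus R d -> R[i]) : Hspace a f -> Hspace a g ->
      fourier (f \- g) k = fourier f k - fourier g k.
    by move=> [fi _] [gi _]; exact: fourierB.
  have FS t (f : torus R d -> R[i]) : Hspace a f -> fourier (schroedinger t f) k =
      expi (- (t * sqrk k)) * fourier f k.
    exact: fourier_schroedinger.
  (* This composition law cancels the two occurrences of the middle value [x1], one from each
     residual. *)
  have ee : expi (- (tau * sqrk k)) =
      expi (- (2 * tau * sqrk k)) * expi (- (- tau * sqrk k)) :> R[i].
    by rewrite -expiD; congr expi; ring.
  have hy := hS (2 * tau) _ hy0; have hB := hS (2 * tau) _ hB1.
  rewrite (FB _ _ hx2 (HspaceB (HspaceD hy hA1) hB)) (FB _ _ (HspaceD hy hA1) hB).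
  rewrite (FD _ _ hy hA1) (FS _ _ hy0) (FS _ _ hB1).
  rewrite (FD _ _ (HspaceD hE hL) hRR) (FD _ _ hE hL).
  rewrite (FB _ _ hRp (hS _ _ hRm)) (FS _ _ hRm) (FB _ _ hLA (hS _ _ hLB)).
  rewrite (FS _ _ hLB) (FS _ _ (HspaceB hx0 hy0)).
  rewrite (FB _ _ hx0 hy0) (FB _ _ hA0 hA1) (FB _ _ hB0 hB1).
  rewrite (FB _ _ hx2 (HspaceD (hS tau _ hx1) hA0)).
  rewrite (FB _ _ hx0 (HspaceD (hS (- tau) _ hx1) hB0)).
  rewrite (FD _ _ (hS tau _ hx1) hA0) (FD _ _ (hS (- tau) _ hx1) hB0).
  rewrite !(FS _ _ hx1) ee; ring.
apply: le_trans (HnormD a (HspaceD hE hL).1 hRR.1) _.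
apply: leeD => //.
apply: le_trans (HnormD a hE.1 hL.1) _.
rewrite -addeA; apply: leeD.
  by rewrite (Hnorm_schroedinger _ a0 (HspaceB hx0 hy0)).
apply: le_trans (HnormB a hLA.1 (hS _ _ hLB).1) _.
by rewrite (Hnorm_schroedinger _ a0 hLB).
Qed.

End ErrorRecursion.

(** * Discrete Gronwall inequality, bootstrap, and bounds on compact sets *)

Section Gronwall.
Context {R : realType}.

(* The step estimate is only available while the numerical solution is known to
   stay within distance 1, hence the hypothesis on the earlier errors. *)
Lemma two_step_gronwall (e : nat -> R) (b r0 r : R) (P : nat -> Prop) :
  0 <= b -> 0 <= r0 -> 0 <= r -> (forall n, P n.+1 -> P n) ->
  (forall n, 0 <= e n) -> e 0%N = 0 -> (P 1%N -> e 1%N <= r0) ->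
  (forall n, P n.+2 -> e n.+1 <= 1 -> e n.+2 <= e n + b * e n.+1 + r) ->
  forall n, P n -> (forall k, (k < n)%N -> e k <= 1) ->
  e n <= expR (b * n%:R) * (r0 + n%:R * r).
Proof.
move=> b0 r00 rr0 Pdec e0 e00 e1 step.
have main n : P n.+1 -> (forall k, (k <= n)%N -> e k <= 1) ->
    e n.+1 + e n <= expR (b * n%:R) * (r0 + n%:R * r).
  elim: n => [P1 _|n IH Pn le1].
    by rewrite e00 addr0 mulr0 expR0 mul1r mul0r addr0 e1.
  have {}IH := IH (Pdec _ Pn) (fun k kn => le1 k (leqW kn)).
  have st := step n Pn (le1 n.+1 (leqnn _)).
  have Xb : 1 + b <= expR b by exact: expR_ge1Dx.
  have -> : b * n.+1%:R = b * n%:R + b by rewrite -natr1 mulrDr mulr1.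
  rewrite expRD -natr1.
  set X := expR (b * n%:R) in IH *; set Y := expR b in Xb *.
  have X1 : 1 <= X by rewrite -expR0 ler_expR mulr_ge0.
  have Y1 : 1 <= Y by rewrite (le_trans _ Xb)// lerDl.
  have nr : 0 <= r0 + n%:R * r by rewrite addr_ge0// mulr_ge0.
  have XY : r <= X * Y * r by rewrite ler_peMl// mulr_ege1.
  have H : (1 + b) * (e n.+1 + e n) <= Y * (X * (r0 + n%:R * r)).
    by apply: ler_pM => //; apply: addr_ge0.
  have en := mulr_ge0 b0 (e0 n); lra.
case=> [_ _|n Pn le1]; first by rewrite e00 !(mulr0, mul0r, expR0, addr0, mul1r).
have := main n Pn (fun k kn => le1 k kn).
have en := e0 n; move=> /(le_trans (_ : e n.+1 <= _)) H.
apply: le_trans (H _) _; first by rewrite lerDl.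
apply: ler_pM; rewrite ?expR_ge0 ?addr_ge0 ?mulr_ge0//.
- by rewrite ler_expR ler_wpM2l// ler_nat.
- by rewrite lerD2l ler_wpM2r// ler_nat.
Qed.

(** Strong induction: the earlier errors are at most K <= 1, which licenses the step estimates up to
    [n], and the Gronwall bound returns K at [n]. *)
Lemma two_step_gronwall_bootstrap (e : nat -> R) (b r0 r K : R)
    (P : nat -> Prop) :
  0 <= b -> 0 <= r0 -> 0 <= r -> (forall n, P n.+1 -> P n) ->
  (forall n, 0 <= e n) -> e 0%N = 0 -> (P 1%N -> e 1%N <= r0) ->
  (forall n, P n.+2 -> e n.+1 <= 1 -> e n.+2 <= e n + b * e n.+1 + r) ->
  (forall n, P n -> expR (b * n%:R) * (r0 + n%:R * r) <= K) -> K <= 1 ->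
  forall n, P n -> e n <= K.
Proof.
move=> b0 r00 rr0 Pdec e0 e00 e1 step PK K1.
elim/ltn_ind => n IH Pn.
have Pk k : (k <= n)%N -> P k.
  move=> /subnK E; move: Pn; rewrite -{1}E.
  by elim: (n - k)%N => // j IHj; rewrite addSn => /Pdec.
apply: le_trans (PK n Pn).
apply: (two_step_gronwall (P := P)) => // k kn.
exact: le_trans (IH k kn (Pk k (ltnW kn))) K1.
Qed.

Lemma continuous_bound (M : R * R -> R) : continuous M ->
  forall x : R, exists2 L, 0 <= L &
    forall p q, 0 <= p <= x -> 0 <= q <= x -> M (p, q) <= L.
Proof.
move=> cM x.
have cK : compact (`[0, x] `*` `[0, x] : set (R * R)).
  by apply: compact_setX; exact: segment_compact.
have := continuous_compact (continuous_subspaceT cM) cK.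
move=> /compact_bounded [L0 [_ LP]].
(* Boundedness is only asserted for constants strictly above [L0]; the absolute value secures
   nonnegativity. *)
exists (`|L0| + 1) => [|p q p0 q0]; first by rewrite addr_ge0.
apply: le_trans (ler_norm _) _.
apply: (LP (`|L0| + 1)); first by rewrite (le_lt_trans (ler_norm _))// ltrDl.
by exists (p, q) => //=; split; rewrite /= in_itv.
Qed.

End Gronwall.

(** * Error estimates for the scheme at a fixed step size *)

Section Scheme.
Context {R : realType} {d : nat}.
Implicit Types (u : R -> torus R d -> R[i]).

Lemma sup_Hnorm_ge a u t1 t2 t : t1 <= t <= t2 ->
  (Hnorm a (u t) <= sup_Hnorm a u t1 t2)%E.
Proof.
by move=> tt; apply: ereal_sup_ubound; exists t => //; rewrite /= in_itv.
Qed.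

Lemma sup_Hnorm_ge0 a u t1 t2 : t1 <= t2 -> (0 <= sup_Hnorm a u t1 t2)%E.
Proof.
move=> tt; apply: le_trans (Hnorm_ge0 a (u t1)) _.
by apply: sup_Hnorm_ge; rewrite lexx.
Qed.

(** Finiteness matters here: [fine] sends +oo to 0 and is monotone on finite values only. *)
Lemma fine_sup_Hnorm_le a u t1 t2 T : 0 <= t1 -> t1 <= t2 -> t2 <= T ->
  (sup_Hnorm a u 0 T < +oo)%E ->
  0 <= fine (sup_Hnorm a u t1 t2) <= fine (sup_Hnorm a u 0 T).
Proof.
move=> t10 t12 t2T fT.
have le : (sup_Hnorm a u t1 t2 <= sup_Hnorm a u 0 T)%E.
  apply: le_ereal_sup => _ [t /= + <-]; rewrite in_itv /= => /andP[t1t tt2].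
  by exists t => //=; rewrite in_itv /= (le_trans t10 t1t) (le_trans tt2 t2T).
rewrite fine_ge0 ?sup_Hnorm_ge0//= fine_le//.
- by rewrite ge0_fin_numE ?sup_Hnorm_ge0// (le_lt_trans le).
- by rewrite ge0_fin_numE// sup_Hnorm_ge0// (le_trans t10 (le_trans t12 t2T)).
Qed.

(** The solution takes its datum almost everywhere, whereas the scheme starts from [u0] itself; this
    makes the initial error vanish in norm. *)
Lemma ae_eq_Hnorm0 a (f g : torus R d -> R[i]) :
  integrable_torus f -> integrable_torus g ->
  ae_eq (torus_prob d) setT f g -> Hnorm a (f \- g) = 0%E.
Proof.
move=> fi gi fg.
have E k : fourier (f \- g) k = 0.
  rewrite fourierB//; apply/eqP; rewrite subr_eq0; apply/eqP.
  have [f1 f2] := cintegrableM fi (unit_bounded_expi_Ndotk k).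
  have [g1 g2] := cintegrableM gi (unit_bounded_expi_Ndotk k).
  apply: complex_ext; congr fine; apply: ae_eq_integral => //.
  - exact: (measurable_int _ f1).
  - exact: (measurable_int _ g1).
  - by apply: filterS fg => x fgx /fgx ->.
  - exact: (measurable_int _ f2).
  - exact: (measurable_int _ g2).
  - by apply: filterS fg => x fgx /fgx ->.
rewrite /Hnorm (_ : (\esum_(k in _) _)%E = 0%E) ?sqrte0//.
by apply: esum1 => k _; rewrite E Normc.normc0 expr0n mulr0.
Qed.

Section Step.
Variables (Phit : R -> (torus R d -> R[i]) -> (torus R d -> R[i])).
Variables (a tau L x T : R) (u : R -> torus R d -> R[i]).
Variable u0 : torus R d -> R[i].
Variable M : R * R -> R.
Hypotheses (a0 : 0 <= a) (tau_gt0 : 0 < tau).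
Hypothesis hu : forall t, 0 <= t <= T -> Hspace a (u t).
Hypothesis ux : forall t, 0 <= t <= T -> fine (Hnorm a (u t)) <= x.
Hypothesis hu0 : Hspace a u0.
Hypothesis u0E : Hnorm a (u 0 \- u0) = 0%E.
Hypothesis hPhi : forall s v, s = tau \/ s = - tau ->
  Hspace a v -> Hspace a (Phit s v).
Hypothesis lip : forall s v w, s = tau \/ s = - tau ->
  Hspace a v -> Hspace a w ->
  (Hnorm a (Phit s v \- Phit s w)%R <=
    (tau * M (fine (Hnorm a v), fine (Hnorm a w)))%:E * Hnorm a (v \- w)%R)%E.
Hypothesis ML : forall p q, 0 <= p <= x + 1 -> 0 <= q <= x + 1 -> M (p, q) <= L.

Local Notation y := (two_step Phit tau u0).
Local Notation e := (fun n : nat => fine (Hnorm a (u (n%:R * tau) \- y n))).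

Lemma Hspace_two_step n : Hspace a (y n).
Proof.
suff : Hspace a (y n) /\ Hspace a (y n.+1) by case.
elim: n => [|n [IH1 IH2]].
  split; first exact: hu0.
  exact: HspaceD (Hspace_schroedinger tau a0 hu0) (hPhi (or_introl erefl) hu0).
split; first exact: IH2.
have hA : Hspace a (Phit tau (y n.+1)) := hPhi (or_introl erefl) IH2.
have hB : Hspace a (Phit (- tau) (y n.+1)) := hPhi (or_intror erefl) IH2.
exact: HspaceB (HspaceD (Hspace_schroedinger (2 * tau) a0 IH1) hA)
  (Hspace_schroedinger (2 * tau) a0 hB).
Qed.

Let time (n : nat) : n%:R * tau <= T -> 0 <= n%:R * tau <= T.
Proof. by move=> ->; rewrite andbT mulr_ge0// ltW. Qed.

Lemma Hspace_error n : n%:R * tau <= T -> Hspace a (u (n%:R * tau) \- y n).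
Proof. by move=> nT; apply: HspaceB (hu (time nT)) (Hspace_two_step n). Qed.

(** Besides the residual, the error contains the effect of replacing u(0) by [u0]; it is zero in
    norm, by isometry for the free flow and by the Lipschitz bound for [Phit]. *)
Lemma first_step_error : 1%:R * tau <= T ->
  (Hnorm a (u (1%:R * tau) \- y 1%N)%R <= Hnorm a (residual Phit u tau 0 tau))%E.
Proof.
move=> T1; have T0 : 0%:R * tau <= T by rewrite mul0r (le_trans _ T1)// mulr_ge0// ltW.
have h0 : Hspace a (u 0) by have := hu (time T0); rewrite mul0r.
have h1 := hu (time T1).
have hA0 : Hspace a (Phit tau (u 0)) by apply: hPhi h0; left.
have hA1 : Hspace a (Phit tau u0) by apply: hPhi hu0; left.
have hS0 := Hspace_schroedinger tau a0 h0.
have hS1 := Hspace_schroedinger tau a0 hu0.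
have -> : u (1%:R * tau) \- y 1%N = residual Phit u tau 0 tau \+
    ((schroedinger tau (u 0) \- schroedinger tau u0)
     \+ (Phit tau (u 0) \- Phit tau u0)).
  by apply/funext => z; rewrite /residual /flow mul0r add0r mul1r /=; ring.
have hr : Hspace a (residual Phit u tau 0 tau).
  rewrite /residual /flow mul0r add0r -[tau in u tau]mul1r.
  exact: HspaceB h1 (HspaceD hS0 hA0).
have hSS := HspaceB hS0 hS1; have hAA := HspaceB hA0 hA1.
apply: le_trans (HnormD a hr.1 (HspaceD hSS hAA).1) _.
rewrite -[leRHS]adde0; apply: leeD => //.
apply: le_trans (HnormD a hSS.1 hAA.1) _.
rewrite -[leRHS]adde0; apply: leeD.
  rewrite -u0E (@eq_Hnorm _ _ a _ (u 0 \- u0))// => k.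
  rewrite (fourierB k hS0.1 hS1.1) (fourierB k h0.1 hu0.1).
  rewrite (fourier_schroedinger _ _ a0 h0) (fourier_schroedinger _ _ a0 hu0).
  by rewrite -mulrBr Normc.normcM normc_expi mul1r.
by apply: le_trans (lip (or_introl erefl) h0 hu0) _; rewrite u0E mule0.
Qed.

Lemma next_step_error n (r : R) : n.+2%:R * tau <= T -> e n.+1 <= 1 ->
  (Hnorm a (residual Phit u tau n.+1 tau \-
     schroedinger (2 * tau) (residual Phit u tau n.+1 (- tau)))%R <= r%:E)%E ->
  e n.+2 <= e n + 2 * (tau * L) * e n.+1 + r.
Proof.
move=> T2 e1 rr.
have T1 : n.+1%:R * tau <= T.
  apply: le_trans T2; apply: ler_wpM2r; first exact: ltW.
  by rewrite ler_nat.
have T0 : n%:R * tau <= T.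
  apply: le_trans T1; apply: ler_wpM2r; first exact: ltW.
  by rewrite ler_nat.
have h0 := hu (time T0); have h1 := hu (time T1); have h2 := hu (time T2).
have k0 := Hspace_two_step n; have k1 := Hspace_two_step n.+1.
have := @two_step_error R d a tau _ _ _ _ _ _ _ _ a0 h0 h1 h2 k0
  (hPhi (or_introl erefl) h1) (hPhi (or_intror erefl) h1)
  (hPhi (or_introl erefl) k1) (hPhi (or_intror erefl) k1).
have t2 : n.+2%:R * tau = n.+1%:R * tau + tau by rewrite -natr1 mulrDl mul1r.
have t0 : n%:R * tau = n.+1%:R * tau + - tau by rewrite -natr1 mulrDl mul1r addrK.
have -> : u (n.+2%:R * tau) \- (schroedinger tau (u (n.+1%:R * tau)) \+
    Phit tau (u (n.+1%:R * tau))) = residual Phit u tau n.+1 tau.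
  by rewrite t2.
have -> : u (n%:R * tau) \- (schroedinger (- tau) (u (n.+1%:R * tau)) \+
    Phit (- tau) (u (n.+1%:R * tau))) = residual Phit u tau n.+1 (- tau).
  by rewrite t0.
(* The exact solution has norm at most [x] and the error is at most 1, so both arguments of [M] lie
   in the range where [L] bounds it. *)
have hy : fine (Hnorm a (y n.+1)) <= x + 1.
  have := HnormB a h1.1 (Hspace_error T1).1.
  have -> : u (n.+1%:R * tau) \- (u (n.+1%:R * tau) \- y n.+1) = y n.+1.
    by apply/funext => z /=; ring.
  rewrite -(Hnorm_fineK k1) -(Hnorm_fineK h1) -(Hnorm_fineK (Hspace_error T1)).
  rewrite -EFinD lee_fin => H; apply: le_trans H _.
  exact: lerD (ux (time T1)) e1.
have lipL s : s = tau \/ s = - tau ->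
    (Hnorm a (Phit s (u (n.+1%:R * tau)) \- Phit s (y n.+1))%R <=
     (tau * L * e n.+1)%:E)%E.
  move=> ss; apply: le_trans (lip ss h1 k1) _.
  rewrite -(Hnorm_fineK (Hspace_error T1)) -EFinM lee_fin.
  apply: ler_wpM2r; first exact/fine_ge0/Hnorm_ge0.
  apply: ler_wpM2l; first exact: ltW.
  apply: ML; apply/andP; split.
  - exact/fine_ge0/Hnorm_ge0.
  - by apply: le_trans (ux (time T1)) _; rewrite lerDl.
  - exact/fine_ge0/Hnorm_ge0.
  - exact: hy.
have := lipL _ (or_introl erefl); have := lipL _ (or_intror erefl).
move=> lB lA H.
have {}H := le_trans H (leeD (leeD (leeD (lexx _) lA) lB) rr).
move: H; rewrite -(Hnorm_fineK (Hspace_error T0)) -!EFinD.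
rewrite -[X in (X <= _)%E](Hnorm_fineK (Hspace_error T2)) lee_fin => H.
have -> : e n + 2 * (tau * L) * e n.+1 + r =
  e n + tau * L * e n.+1 + tau * L * e n.+1 + r.
  by rewrite -[2 * _ * _]mulrA [2 * _]mulr_natl mulr2n addrA.
exact: H.
Qed.

Section Global.
Variables r0 r : R.
Hypotheses (L0 : 0 <= L) (r0_ge0 : 0 <= r0) (r_ge0 : 0 <= r).
Hypothesis first_residual : 1%:R * tau <= T ->
  (Hnorm a (residual Phit u tau 0 tau) <= r0%:E)%E.
Hypothesis next_residual : forall n, n.+2%:R * tau <= T ->
  (Hnorm a (residual Phit u tau n.+1 tau \-
     schroedinger (2 * tau) (residual Phit u tau n.+1 (- tau)))%R <= r%:E)%E.

Let P n := n%:R * tau <= T.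

Let Pdec n : P n.+1 -> P n.
Proof.
apply: le_trans; apply: ler_wpM2r; first exact: ltW.
by rewrite ler_nat.
Qed.

Let e_ge0 n : 0 <= e n. Proof. exact/fine_ge0/Hnorm_ge0. Qed.

Let e0E : e 0%N = 0. Proof.
by rewrite -[LHS]/(fine (Hnorm a (u (0%:R * tau) \- u0))) mul0r u0E.
Qed.

Let e1_le : P 1%N -> e 1%N <= r0.
Proof.
move=> P1; rewrite -lee_fin (Hnorm_fineK (Hspace_error P1)).
exact: le_trans (first_step_error P1) (first_residual P1).
Qed.

Let b_ge0 : 0 <= 2 * (tau * L).
Proof. by rewrite !mulr_ge0// ltW. Qed.

(** Since n tau <= T, the exponent stays below 2 L T and at most T / tau residuals accumulate, which
    removes [n] from the bound. *)
Let growth n : P n -> expR (2 * (tau * L) * n%:R) * (r0 + n%:R * r) <=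
  expR (2 * (L * T)) * (r0 + T / tau * r).
Proof.
move=> Pn; apply: ler_pM; rewrite ?expR_ge0//.
- by apply: addr_ge0 => //; apply: mulr_ge0.
- rewrite ler_expR -mulrA ler_wpM2l// mulrAC mulrC ler_wpM2l//.
  by rewrite mulrC.
- by rewrite lerD2l ler_wpM2r// ler_pdivlMr.
Qed.

Lemma error_bootstrap K :
  expR (2 * (L * T)) * (r0 + T / tau * r) <= K -> K <= 1 ->
  forall n, n%:R * tau <= T -> e n <= K.
Proof.
move=> rK K1.
apply: (two_step_gronwall_bootstrap b_ge0 r0_ge0 r_ge0 Pdec e_ge0 e0E e1_le) => //.
  by move=> n P2 e1; exact: next_step_error P2 e1 (next_residual P2).
by move=> n Pn; exact: le_trans (growth Pn) rK.
Qed.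

(** Closeness to the solution is an assumption here, so smaller residuals improve the rate without
    any further restriction on [tau]. *)
Lemma error_bound : (forall n, n%:R * tau <= T -> e n <= 1) ->
  forall n, n%:R * tau <= T ->
  e n <= expR (2 * (L * T)) * (r0 + T / tau * r).
Proof.
move=> le1 n Pn; apply: le_trans (growth Pn).
apply: (two_step_gronwall b_ge0 r0_ge0 r_ge0 Pdec e_ge0 e0E e1_le) => //.
  by move=> m P2 e1; exact: next_step_error P2 e1 (next_residual P2).
move=> k kn; apply: le1; apply: le_trans Pn.
by apply: ler_wpM2r; [exact: ltW|rewrite ler_nat ltnW].
Qed.

End Global.

End Step.

End Scheme.

(** * Uniform bounds on the local errors over [0, T] *)

Section Residuals.
Context {R : realType} {d : nat}.
Implicit Types (u : R -> torus R d -> R[i]).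

Lemma fine_Hnorm_le_sup a b u T t : a <= b -> 0 <= t <= T ->
  (sup_Hnorm b u 0 T < +oo)%E ->
  fine (Hnorm a (u t)) <= fine (sup_Hnorm b u 0 T).
Proof.
move=> ab tT fT; have le : (Hnorm a (u t) <= sup_Hnorm b u 0 T)%E.
  exact: le_trans (le_Hnorm (u t) ab) (sup_Hnorm_ge b u tT).
have T0 : 0 <= T by case/andP: tT => t0; exact: le_trans.
rewrite fine_le//.
- by rewrite ge0_fin_numE ?Hnorm_ge0// (le_lt_trans le).
- by rewrite ge0_fin_numE// sup_Hnorm_ge0.
Qed.

(** The absolute value keeps the constant nonnegative at every real argument, while a profile is
    only known to be nonnegative on [0, +oo). *)
Lemma profile_le (C : R -> R) b u t1 t2 T :
  increasing_profile C -> 0 <= t1 -> t1 <= t2 -> t2 <= T ->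
  (sup_Hnorm b u 0 T < +oo)%E ->
  C (fine (sup_Hnorm b u t1 t2)) <= `|C (fine (sup_Hnorm b u 0 T))|.
Proof.
move=> [_ _ Cmono] t10 t12 t2T fT.
have /andP[h1 h2] := fine_sup_Hnorm_le t10 t12 t2T fT.
exact: le_trans (Cmono _ _ h1 h2) (ler_norm _).
Qed.

Variables (Phit : R -> (torus R d -> R[i]) -> (torus R d -> R[i])).

Lemma local_error_forward u a b T taus p C tau n :
  increasing_profile C -> local_error Phit u a b T taus p C ->
  (sup_Hnorm b u 0 T < +oo)%E ->
  0 < tau <= taus -> n.+1%:R * tau <= T ->
  (Hnorm a (residual Phit u tau n tau) +
   Hnorm a (residual Phit u tau n.+1 (- tau)) <=
   (tau ^+ p.+1 * `|C (fine (sup_Hnorm b u 0 T))|)%:E)%E.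
Proof.
move=> Cprof le fT tt nT; have /andP[tau0 _] := tt.
apply: le_trans (le tau tt n _) _.
  by rewrite lerBrDr natr1 ler_pdivlMr.
rewrite lee_fin ler_wpM2l ?exprn_ge0 ?(ltW tau0)//.
apply: profile_le => //; first by rewrite mulr_ge0// ltW.
by rewrite ler_pM2r// ler_nat.
Qed.

Lemma symmetric_local_error_le u a b T taus p C tau n :
  increasing_profile C -> symmetric_local_error Phit u a b T taus p C ->
  (sup_Hnorm b u 0 T < +oo)%E ->
  0 < tau <= taus -> n.+2%:R * tau <= T ->
  (Hnorm a (residual Phit u tau n.+1 tau \-
     schroedinger (2 * tau) (residual Phit u tau n.+1 (- tau)))%R <=
   (tau ^+ p.+2 * `|C (fine (sup_Hnorm b u 0 T))|)%:E)%E.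
Proof.
move=> Cprof le fT tt nT; have /andP[tau0 _] := tt.
apply: le_trans (le tau tt n.+1 _ _) _ => //.
  by rewrite lerBrDr natr1 ler_pdivlMr.
rewrite lee_fin ler_wpM2l ?exprn_ge0 ?(ltW tau0)//.
apply: profile_le => //; first by rewrite mulr_ge0// ltW.
by rewrite ler_pM2r// ler_nat ltnW.
Qed.

End Residuals.

(** * Global convergence: choice of the constants, order p, order p + 1 *)

Theorem theorem3p3 (R : realType) (alpha T taus : R) (p : nat)
    (M : R * R -> R) (C Ct : R -> R) :
  0 <= alpha -> 0 < T -> 0 < taus -> (1 <= p)%N ->
  continuous M -> (forall z, 0 <= M z) ->
  increasing_profile C -> increasing_profile Ct ->
  exists tau0 K1 K2 : R -> R,
    (forall x, [/\ 0 < tau0 x, 0 < K1 x & 0 < K2 x]) /\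
    forall (d : nat) (mu gamma1 gamma2 : R) (u0 : torus R d -> R[i])
      (u : R -> torus R d -> R[i]) (Tmax : \bar R)
      (Phit : R -> (torus R d -> R[i]) -> (torus R d -> R[i])),
    (1 <= d <= 3)%N -> mu != 0 -> 0 <= gamma1 -> 0 <= gamma2 ->
    nls_maximal_solution mu alpha u0 Tmax u -> (T%:E < Tmax)%E ->
    (forall tau : R, 0 < tau <= taus -> forall v, Hspace alpha v ->
       Hspace alpha (Phit tau v) /\ Hspace alpha (Phit (- tau) v)) ->
    flow_lipschitz Phit alpha taus M ->
    local_error Phit u alpha (alpha + gamma1) T taus p C ->
    (sup_Hnorm (alpha + gamma1)%R u 0%R T < +oo)%E ->
    (forall tau : R,
       0 < tau <= tau0 (fine (sup_Hnorm (alpha + gamma1) u 0 T)) ->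
     forall n : nat, n%:R <= T / tau ->
     (Hnorm alpha (u (n%:R * tau)%R \- two_step Phit tau u0 n) <=
       (K1 (fine (sup_Hnorm (alpha + gamma1) u 0 T)) * tau ^+ p)%:E)%E) /\
    (odd p ->
     symmetric_local_error Phit u alpha (alpha + gamma1 + gamma2) T taus p Ct ->
     (sup_Hnorm (alpha + gamma1 + gamma2)%R u 0%R T < +oo)%E ->
     forall tau : R,
       0 < tau <= tau0 (fine (sup_Hnorm (alpha + gamma1) u 0 T)) ->
     forall n : nat, n%:R <= T / tau ->
     (Hnorm alpha (u (n%:R * tau)%R \- two_step Phit tau u0 n) <=
       (K2 (fine (sup_Hnorm (alpha + gamma1 + gamma2) u 0 T)) *
        tau ^+ p.+1)%:E)%E).
Proof.
move=> alpha0 T0 taus0 p1 cM M0 Cprof Ctprof.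
(* The Lipschitz bound is needed as a function of the norm bound [x], because the constants built
   from it are fixed before the solution is introduced. *)
have Lex (x : R) : exists l, 0 <= l /\
    forall q r, 0 <= q <= x + 1 -> 0 <= r <= x + 1 -> M (q, r) <= l.
  by have [l l0 lP] := continuous_bound cM (x + 1); exists l.
have [L LP] := choice Lex.
(* In [K1] the first step contributes |C| tau^(p+1) <= |C| tau^p and T / tau steps contribute 2 |C|
   tau^(p+1) each. In [K2] the first step already has order p + 1 and the others contribute |Ct|
   tau^(p+2) each. The final 1 gives positivity. *)
pose K1 x := expR (2 * (L x * T)) * ((1 + 2 * T) * `|C x|) + 1.
pose K2 x := expR (2 * (L x * T)) * (`|C x| + T * `|Ct x|) + 1.
(* The last two bounds, with p >= 1, give K1 tau^p <= K1 tau <= 1, the smallness that the bootstrap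
   requires. *)
pose tau0 x := Num.min taus (Num.min 1 (K1 x)^-1).
have T1 : 0 <= 1 + 2 * T by rewrite addr_ge0// mulr_ge0// ltW.
have K1_gt0 x : 0 < K1 x by rewrite ltr_wpDl// mulr_ge0 ?expR_ge0// mulr_ge0.
have K2_gt0 x : 0 < K2 x.
  rewrite ltr_wpDl// mulr_ge0 ?expR_ge0// addr_ge0// mulr_ge0// ltW//.
exists tau0, K1, K2; split.
  by move=> x; split => //; rewrite !lt_min taus0 ltr01 invr_gt0 K1_gt0.
move=> d mu gamma1 gamma2 u0 u Tmax Phit _ _ g1 g2 [hu0 sol u00 _] TTmax
  hPhi lip lerr fsup.
set x := fine (sup_Hnorm (alpha + gamma1) u 0 T).
have hu t : 0 <= t <= T -> Hspace alpha (u t).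
  move=> /andP[t0 tT]; have tTm : (t%:E < Tmax)%E.
    by apply: le_lt_trans TTmax; rewrite lee_fin.
  by have [] := sol t t0 tTm.
have T00 : (0 : R) <= 0 <= T by apply/andP; split; [exact: lexx|exact: ltW].
have u0E : Hnorm alpha (u 0 \- u0) = 0%E.
  exact: ae_eq_Hnorm0 (hu _ T00).1 hu0.1 u00.
have tauP tau : 0 < tau <= tau0 x ->
    [/\ 0 < tau, 0 < tau <= taus, tau <= 1 & K1 x * tau <= 1].
  move=> /andP[t0]; rewrite !le_min => /and3P[t1 t2 t3]; split => //.
    by rewrite t0.
  by rewrite mulrC -ler_pdivlMr// div1r.
have hPhi' tau : 0 < tau <= taus -> forall s v, s = tau \/ s = - tau ->
    Hspace alpha v -> Hspace alpha (Phit s v).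
  by move=> tt s v [->|->] /(hPhi tau tt) [].
have agE : alpha <= alpha + gamma1 by rewrite lerDl.
have Kpow tau : 0 < tau -> tau <= 1 -> K1 x * tau <= 1 -> K1 x * tau ^+ p <= 1.
  move=> t0 t1; apply: le_trans; apply: ler_wpM2l; first exact: ltW.
  case: (p) p1 => // q _; rewrite exprS ler_piMr ?exprn_ile1 //; exact: ltW.
have part1 tau : 0 < tau <= tau0 x -> forall n, n%:R * tau <= T ->
    fine (Hnorm alpha (u (n%:R * tau) \- two_step Phit tau u0 n)) <=
    K1 x * tau ^+ p.
  move=> /tauP[tau_gt0 tt tau1 Ktau].
  have tp k : 0 <= tau ^+ k by rewrite exprn_ge0// ltW.
  apply: (@error_bootstrap _ _ Phit alpha tau (L x) x T u u0 M alpha0 tau_gt0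
    hu (fun t tT => fine_Hnorm_le_sup agE tT fsup) hu0 u0E (hPhi' _ tt)
    (fun s v w ss => lip tau tt s ss v w) (LP x).2
    (tau ^+ p.+1 * `|C x|) (2 * (tau ^+ p.+1 * `|C x|)) (LP x).1).
  - by rewrite mulr_ge0.
  - by rewrite !mulr_ge0.
  - move=> h; apply: le_trans (local_error_forward Cprof lerr fsup tt h).
    by rewrite leeDl// Hnorm_ge0.
  - move=> n nT.
    have n1 : n.+1%:R * tau <= T.
      by apply: le_trans nT; apply: ler_wpM2r; [exact: ltW|rewrite ler_nat].
    have hr s : s = tau \/ s = - tau -> 0 <= n.+1%:R * tau + s <= T ->
        Hspace alpha (residual Phit u tau n.+1 s).
      move=> ss sT; have h1 : Hspace alpha (u (n.+1%:R * tau)).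
        by apply: hu; rewrite n1 mulr_ge0// ltW.
      exact: HspaceB (hu _ sT)
        (HspaceD (Hspace_schroedinger s alpha0 h1) (hPhi' _ tt _ _ ss h1)).
    have hp : Hspace alpha (residual Phit u tau n.+1 tau).
      apply: hr; first by left.
      have -> : n.+1%:R * tau + tau = n.+2%:R * tau by rewrite -[n.+2%:R]natr1 mulrDl mul1r.
      by rewrite nT mulr_ge0// ltW.
    have hm : Hspace alpha (residual Phit u tau n.+1 (- tau)).
      apply: hr; first by right.
      have -> : n.+1%:R * tau + - tau = n%:R * tau.
        by rewrite -natr1 mulrDl mul1r addrK.
      rewrite mulr_ge0 ?(ltW tau_gt0)//=; apply: le_trans n1.
      by apply: ler_wpM2r; [exact: ltW|rewrite ler_nat].
    apply: le_trans (HnormB alpha hp.1 (Hspace_schroedinger _ alpha0 hm).1) _.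
    rewrite (Hnorm_schroedinger _ alpha0 hm) mulr_natl mulr2n EFinD.
    (* The forward residual at t_{n+1} is controlled by the local error on [t_{n+1}, t_{n+2}], the
       backward one by that on [t_n, t_{n+1}]; hence the factor 2. *)
    apply: leeD.
      apply: le_trans (local_error_forward Cprof lerr fsup tt nT).
      by rewrite leeDl// Hnorm_ge0.
    apply: le_trans (local_error_forward Cprof lerr fsup tt n1).
    by rewrite leeDr// Hnorm_ge0.
  - rewrite /K1 [leRHS]mulrDl mul1r -[X in _ <= X + _]mulrA; apply: ler_wpDr => //.
    apply: ler_wpM2l; first exact: expR_ge0.
    have -> : T / tau * (2 * (tau ^+ p.+1 * `|C x|)) = 2 * T * `|C x| * tau ^+ p.
      by rewrite exprS; field; rewrite gt_eqF.
    have -> : (1 + 2 * T) * `|C x| * tau ^+ p =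
      `|C x| * tau ^+ p + 2 * T * `|C x| * tau ^+ p by ring.
    rewrite lerD2r [leLHS]mulrC; apply: ler_wpM2l => //.
    by rewrite exprS ler_piMl.
  - exact: Kpow.
have nT tau n : 0 < tau -> (n%:R <= T / tau) = (n%:R * tau <= T).
  by move=> t0; rewrite ler_pdivlMr.
have fineE tau n : 0 < tau <= tau0 x -> n%:R * tau <= T ->
    (fine (Hnorm alpha (u (n%:R * tau) \- two_step Phit tau u0 n)))%:E =
    Hnorm alpha (u (n%:R * tau) \- two_step Phit tau u0 n).
  move=> /tauP[tau_gt0 tt _ _] h; apply: Hnorm_fineK.
  exact: Hspace_error alpha0 tau_gt0 hu hu0 (hPhi' _ tt) _ h.
split.
  move=> tau tt n; have [tau_gt0 _ _ _] := tauP _ tt.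
  rewrite nT// => h; rewrite -fineE// lee_fin; exact: part1.
move=> _ serr fsup2; set y := fine (sup_Hnorm (alpha + gamma1 + gamma2) u 0 T).
move=> tau tt0 n; have [tau_gt0 tt tau1 Ktau] := tauP _ tt0.
rewrite nT// => h; rewrite -fineE// lee_fin.
have agE2 : alpha <= alpha + gamma1 + gamma2 by rewrite -addrA lerDl addr_ge0.
(* The first step is still measured by [C] at the weaker norm; monotonicity moves it to the stronger
   one, so that [K2] depends on [y] alone. *)
have xy : `|C x| <= `|C y|.
  have x0 : 0 <= x by exact/fine_ge0/sup_Hnorm_ge0/ltW.
  have [_ Cge0 Cmono] := Cprof; rewrite (ger0_norm (Cge0 _ x0)).
  apply: le_trans (ler_norm _); apply: (Cmono _ _ x0).
  have s1 := sup_Hnorm_ge0 (alpha + gamma1) u (ltW T0).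
  have s2 := sup_Hnorm_ge0 (alpha + gamma1 + gamma2) u (ltW T0).
  apply: fine_le; [by rewrite (ge0_fin_numE s1)|by rewrite (ge0_fin_numE s2)|].
  apply: ub_ereal_sup => _ [t tT <-].
  apply: le_trans (le_Hnorm (u t) _) (sup_Hnorm_ge _ u _); first by rewrite lerDl.
  by move: tT; rewrite /= in_itv.
have tp k : 0 <= tau ^+ k by rewrite exprn_ge0// ltW.
apply: le_trans (_ : _ <= expR (2 * (L y * T)) *
    (tau ^+ p.+1 * `|C y| + T / tau * (tau ^+ p.+2 * `|Ct y|))) _.
  apply: (@error_bound _ _ Phit alpha tau (L y) y T u u0 M alpha0 tau_gt0
    hu (fun t tT => fine_Hnorm_le_sup agE2 tT fsup2) hu0 u0E (hPhi' _ tt)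
    (fun s v w ss => lip tau tt s ss v w) (LP y).2
    (tau ^+ p.+1 * `|C y|) (tau ^+ p.+2 * `|Ct y|) (LP y).1) => //.
  - by rewrite mulr_ge0.
  - by rewrite mulr_ge0.
  - move=> kT; apply: (@le_trans _ _ (tau ^+ p.+1 * `|C x|)%:E).
      apply: le_trans (local_error_forward Cprof lerr fsup tt kT).
      by rewrite leeDl// Hnorm_ge0.
    by rewrite lee_fin ler_wpM2l.
  - by move=> k; exact: symmetric_local_error_le serr fsup2 tt.
  (* The order p estimate supplies the closeness hypothesis, which is why the same [tau0] serves
     both conclusions. *)
  - move=> k kT; apply: le_trans (part1 _ tt0 _ kT) _.
    exact: Kpow.
rewrite /K2 [leRHS]mulrDl mul1r -[X in _ <= X + _]mulrA; apply: ler_wpDr => //.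
apply: ler_wpM2l; first exact: expR_ge0.
have -> : T / tau * (tau ^+ p.+2 * `|Ct y|) = T * `|Ct y| * tau ^+ p.+1.
  by rewrite exprS; field; rewrite gt_eqF.
by rewrite mulrDl [tau ^+ _ * _]mulrC.
Qed.
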